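(* \textsc{Isometric Path Partition} admits an algorithm running in time $n^{O(\mathsf{tw})}$, where $\mathsf{tw}$ is the treewidth of the input graph $G$ and $n$ denotes its number of vertices.
   Context: All graphs are finite, simple and undirected. A path in a graph $G$ is isometric if it is a shortest path in $G$ between its two endpoints. In the problem \textsc{Isometric Path Partition}, the input is a graph $G$ and an integer $k$, and the question is whether the vertex set of $G$ can be partitioned into $k$ sets, each of which induces (the vertex set of) an isometric path of $G$. *)

(* Defs.v *)
From mathcomp Require Import all_boot.
From mathcomp Require Import boolp.

Set Implicit Arguments.
Unset Strict Implicit.
Unset Printing Implicit Defensive.

Record sgraph (V : finType) := SGraph {
  adj :> rel V;
  adj_sym : symmetric adj;
  adj_irrefl : irreflexive adj }.

Section IsometricPaths.
Context {V : finType}.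
Variable G : sgraph V.

(* The path with vertex sequence x :: p, of length size p. *)
Definition is_path (x : V) (p : seq V) : Prop := path G x p /\ uniq (x :: p).

Definition isometric_path (x : V) (p : seq V) : Prop :=
  is_path x p /\
  forall q, is_path x q -> last x q = last x p -> size p <= size q.

Definition isometric_path_partition (k : nat) : Prop :=
  exists P : {set {set V}},
    [/\ partition P [set: V], #|P| = k &
        forall S, S \in P ->
          exists x p, isometric_path x p /\ S = [set v in x :: p]].

End IsometricPaths.

(* A repetition-free cyclic sequence of two vertices runs back and forth along
   an edge; a cycle of the graph is one with at least three vertices. *)
Definition is_tree (T : finType) (F : sgraph T) : Prop :=
  [/\ 0 < #|T|, forall s t : T, connect F s t &
      forall c : seq T, ucycle F c -> size c <= 2].

Section Treewidth.
Context {V : finType}.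
Variable G : sgraph V.

Definition tree_decomposition (T : finType) (F : sgraph T)
    (bag : T -> {set V}) : Prop :=
  [/\ is_tree F,
      forall v, exists t, v \in bag t,
      forall u v, G u v -> exists t, (u \in bag t) && (v \in bag t) &
      forall v s t, v \in bag s -> v \in bag t ->
        connect [rel i j | [&& F i j, v \in bag i & v \in bag j]] s t].

Definition width (T : finType) (bag : T -> {set V}) : nat :=
  (\max_(t : T) #|bag t|).-1.

Definition has_width (w : nat) : Prop :=
  exists (T : finType) (F : sgraph T) (bag : T -> {set V}),
    tree_decomposition F bag /\ width bag = w.

Lemma ex_has_width : exists w, `[< has_width w >].
Proof.
pose e := [rel _ _ : unit | false].
pose F : sgraph unit := @SGraph unit e (fun _ _ => erefl) (fun _ => erefl).
exists (width (fun _ : unit => [set: V])); apply/asboolP.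
exists unit, F, (fun _ => [set: V]); split=> //; split.
- split; first by rewrite card_unit.
  + by move=> [] []; apply: connect0.
  + by case=> [|x [|y c]] //=; rewrite /ucycle /ucycleb /= ?andbF.
- by move=> v; exists tt; rewrite inE.
- by move=> u v _; exists tt; rewrite !inE.
- by move=> v [] [] _ _; apply: connect0.
Qed.

(* The graph without vertices gets treewidth 0 (and not -1). *)
Definition treewidth : nat := ex_minn ex_has_width.

End Treewidth.

(* Random access machine with structured control flow.  It has a read-only
   input, a work memory that is initially 0 everywhere, and indirect addressing
   in both; cells hold natural numbers.  Every node of an expression and every
   command executed costs one unit.  There is no multiplication: the numbers
   arising within t steps have O(t) more bits than those in the input and the
   program, so that this unit cost is polynomially related to Turing machine
   time. *)
Inductive expr :=
| EConst of nat
| EInput of expr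
| ELoad of expr
| EAdd of expr & expr
| ESub of expr & expr.

Inductive cmd :=
| CSkip
| CStore of expr & expr
| CSeq of cmd & cmd
| CIf of expr & cmd & cmd
| CWhile of expr & cmd.

Definition memory := nat -> nat.

Definition memory0 : memory := fun=> 0.

Definition update (m : memory) (a v : nat) : memory :=
  fun b => if b == a then v else m b.

Fixpoint eval (inp : seq nat) (m : memory) (e : expr) : nat :=
  match e with
  | EConst c => c
  | EInput a => nth 0 inp (eval inp m a)
  | ELoad a => m (eval inp m a)
  | EAdd e1 e2 => eval inp m e1 + eval inp m e2
  | ESub e1 e2 => eval inp m e1 - eval inp m e2
  end.

Fixpoint cost (e : expr) : nat :=
  match e with
  | EConst _ => 1
  | EInput a | ELoad a => (cost a).+1
  | EAdd e1 e2 | ESub e1 e2 => (cost e1 + cost e2).+1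
  end.

(* exec inp c m t m' : on input inp, command c started in memory m halts after
   t units of time in memory m'. *)
Inductive exec (inp : seq nat) : cmd -> memory -> nat -> memory -> Prop :=
| exec_Skip m : exec inp CSkip m 1 m
| exec_Store a e m :
    exec inp (CStore a e) m (cost a + cost e).+1
      (update m (eval inp m a) (eval inp m e))
| exec_Seq c1 c2 m t1 m1 t2 m2 :
    exec inp c1 m t1 m1 -> exec inp c2 m1 t2 m2 ->
    exec inp (CSeq c1 c2) m (t1 + t2).+1 m2
| exec_IfT e c1 c2 m t m' :
    eval inp m e != 0 -> exec inp c1 m t m' ->
    exec inp (CIf e c1 c2) m (cost e + t).+1 m'
| exec_IfF e c1 c2 m t m' :
    eval inp m e = 0 -> exec inp c2 m t m' ->
    exec inp (CIf e c1 c2) m (cost e + t).+1 m'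
| exec_WhileT e c m t1 m1 t2 m2 :
    eval inp m e != 0 -> exec inp c m t1 m1 ->
    exec inp (CWhile e c) m1 t2 m2 ->
    exec inp (CWhile e c) m (cost e + t1 + t2).+1 m2
| exec_WhileF e c m :
    eval inp m e = 0 -> exec inp (CWhile e c) m (cost e).+1 m.

Lemma exec_det inp c m t1 m1 t2 m2 :
  exec inp c m t1 m1 -> exec inp c m t2 m2 -> t1 = t2 /\ m1 = m2.
Proof.
move=> E; elim: E t2 m2 => {c m t1 m1} => [m|a e m|c1 c2 m t1 m1 t2 m2 _ IH1
  _ IH2|e c1 c2 m t m' He _ IH|e c1 c2 m t m' He _ IH|e c m t1 m1 t2 m2 He _ IH1
  _ IH2|e c m He] t3 m3 E; inversion E as
    [|? ? ?|? ? ? ? ? ? ? E1 E2|? ? ? ? ? ? He' E1|? ? ? ? ? ? He' E1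
    |? ? ? ? ? ? ? He' E1 E2|? ? ? He']; subst => //;
  try by [rewrite He in He' | rewrite He' in He].
- by have [? ?] := IH1 _ _ E1; subst; have [-> ->] := IH2 _ _ E2.
- by have [-> ->] := IH _ _ E1.
- by have [-> ->] := IH _ _ E1.
- by have [? ?] := IH1 _ _ E1; subst; have [-> ->] := IH2 _ _ E2.
Qed.

(* l lists every edge of G exactly once, in one of its two orientations. *)
Definition edge_list n (G : sgraph 'I_n) (l : seq ('I_n * 'I_n)) : Prop :=
  forall u v, count_mem (u, v) l + count_mem (v, u) l = G u v.

Definition encode n (l : seq ('I_n * 'I_n)) (k : nat) : seq nat :=
  [:: n, k, size l & flatten [seq [:: val uv.1; val uv.2] | uv <- l]].

(* Main.v *)
Require Import Defs.
From mathcomp Require Import all_boot zify.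
From mathcomp Require Import boolp.

Set Implicit Arguments.
Unset Strict Implicit.
Unset Printing Implicit Defensive.

(** A partition into isometric paths is the same as a labelling of every vertex v
    by the start x of its path and the neighbours p and s of v on it, subject to
    conditions on single vertices and on edges: the distance from x increases by
    one from p to v, and p and s agree with v about the path. The number of paths
    is the number of vertices with p = v. This is a binary constraint problem with
    O(n^3) labels, solved by dynamic programming over bags of m + 1 labelled
    vertices: given a bag, the components of the rest that touch its head are
    treated one by one in the order of their least vertices, and for such a
    component a new bag is guessed, whose head lies in the component and whose
    tail, taken from the old bag, contains the neighbourhood of the component.

    No tree decomposition is computed. If the trivial partition into n single
    vertices is derivable for m, then relabelling its derivation shows that every
    partition is; so the least m for which this happens decides the instance. A
    tree decomposition of width w shows m <= w: weigh a vertex by the size of the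
    subtree below the topmost node containing it. If the neighbours of a connected
    set D weigh at least as much as all of D, then they share a bag with some
    vertex of D, hence there are at most w of them; and this condition persists
    when the heaviest vertex of D is chosen as the new head. *)

(** * Computing with registers and a heap *)

(** For treewidth 0 the claimed bound is a constant, whatever n is, so such inputs must be settled
    without any loop: a graph without edges is recognised by the edge count in its input, and the
    answer is whether k = n. An edge forces treewidth at least 1 and n >= 2, so that n + 1 and
    constant factors can be absorbed into powers of n.

    The trivial partition solves every graph, so deriving it tests m alone; without such a test a
    negative answer of the table could just mean that the bags are too small. Relabelling works
    because the components below a bag, and whether a new bag separates a component, depend on the
    vertices in the bags and not on their labels, while the conditions on labels hold automatically
    once all labels come from one solution.

    The command has to be fixed before the input, hence before m is known. Everything is therefore
    compiled uniformly in m: the tables for m occupy [cell_count] heap cells, a power of n + 1 with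
    exponent 20 (m + 1), and they are filled in time bounded by one fixed polynomial in that
    number. *)

Definition polyb (K B : nat) := K * B.+1 ^ K.

Lemma leq_polyb K B B' : B <= B' -> polyb K B <= polyb K B'.
Proof. by case: K => [//|K] h; rewrite leq_mul2l leq_exp2r. Qed.

Lemma leq_const_polyb K B : K <= polyb K B.
Proof. by rewrite leq_pmulr // expn_gt0. Qed.

Lemma polybD K1 K2 B : polyb K1 B + polyb K2 B <= polyb (K1 + K2) B.
Proof.
rewrite {3}/polyb mulnDl leq_add // leq_mul // leq_pexp2l //; lia.
Qed.

(** The cost of a loop: at most B rounds raise the exponent K by one. *)
Lemma polybM K B b : b <= B -> b * polyb K B <= polyb K.+1 B.
Proof.
move=> hb; rewrite /polyb expnS.
apply: (@leq_trans (K * (B.+1 * B.+1 ^ K))); last by rewrite leq_mul.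
by rewrite mulnCA leq_mul // leq_mul // ltnW.
Qed.

(** A state on which a program runs: its input, heap and variables, and the number [cbound] in which
    running times are polynomial. Functions of such states are compiled, so that neither the command
    nor the exponent depends on the state. *)
Record ctx := Ctx {
  csort :> Type;
  cinp : csort -> seq nat;
  cheap : csort -> nat -> nat;
  cbound : csort -> nat;
  cvars : seq (csort -> nat) }.

(* Registers live at even addresses, the heap at odd ones; ls tells which
   register holds each variable of the context. *)
Definition stores (X : ctx) (ls : seq nat) (x : X) (m : memory) : Prop :=
  (forall j, j < size ls ->
     m (nth 0 ls j).*2 = nth (fun=> 0) (cvars X) j x) /\
  (forall a, m a.*2.+1 = cheap x a).

Definition agree (s : nat) (m m' : memory) : Prop :=
  forall a, (a < s.*2) || odd a -> m' a = m a.

(** The variables may sit in any registers below s. The result goes to register s, and by [agree]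
    neither the lower registers nor the heap change; hence commands compose by raising s. The heap
    is written only by the filling loop in [table_filled]. *)
Variant computable (X : ctx) (f : X -> nat) : Prop := Computable of
  forall ls s, size ls = size (cvars X) -> all (fun r => r < s) ls ->
  exists (c : cmd) (K : nat), forall (x : X) m, stores ls x m ->
  exists t m', [/\ exec (cinp x) c m t m', t <= polyb K (cbound x),
                   m' s.*2 = f x & agree s m m'].

Lemma agree_trans s m1 m2 m3 : agree s m1 m2 -> agree s m2 m3 -> agree s m1 m3.
Proof. by move=> h1 h2 a ha; rewrite h2 // h1. Qed.

Lemma agreeW s s' m m' : s <= s' -> agree s' m m' -> agree s m m'.
Proof.
move=> hs h a /orP[ha|ha]; apply: h; apply/orP; last by right.
by left; apply: leq_trans ha _; rewrite leq_double.
Qed.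

Lemma agree_update s r m v : s <= r -> agree s m (update m r.*2 v).
Proof.
move=> hs a ha; rewrite /update; case: eqP ha => // ->.
by rewrite odd_double orbF ltn_double ltnNge hs.
Qed.

Lemma stores_agree (X : ctx) ls s (x : X) m m' : all (fun r => r < s) ls ->
  agree s m m' -> stores ls x m -> stores ls x m'.
Proof.
move=> hls hag [h1 h2]; split=> [j hj|a].
  by rewrite hag ?h1 // ltn_double (allP hls _ (mem_nth 0 hj)).
by rewrite hag ?h2 //= odd_double orbT.
Qed.

Lemma all_regW s s' ls : s <= s' ->
  all (fun r => r < s) ls -> all (fun r => r < s') ls.
Proof. by move=> hs; apply: sub_all => r; lia. Qed.

Definition reg (r : nat) := ELoad (EConst r.*2).
Definition set_reg (r : nat) (e : expr) := CStore (EConst r.*2) e.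

Lemma exec_set_reg inp r e m :
  exec inp (set_reg r e) m (cost e).+2 (update m r.*2 (eval inp m e)).
Proof. by have := exec_Store inp (EConst r.*2) e m; rewrite /= add1n. Qed.

Lemma update_same m a v : update m a v a = v.
Proof. by rewrite /update eqxx. Qed.

Lemma update_reg m r s v : r != s -> update m r.*2 v s.*2 = m s.*2.
Proof. by rewrite /update -(inj_eq double_inj) eq_sym => /negPf->. Qed.

Section Closure.
Variable X : ctx.
Implicit Types f g b : X -> nat.

Lemma computable_ext f g : (forall x, f x = g x) -> computable f -> computable g.
Proof.
move=> e [h]; split=> ls s h1 h2; have [c [K H]] := h ls s h1 h2; exists c, K => x m hm.
by have [t [m' [? ? ? ?]]] := H x m hm; exists t, m'; rewrite -e.
Qed.

Lemma computable_expr (e : expr) f :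
  (forall x m, (forall a, m a.*2.+1 = cheap x a) -> eval (cinp x) m e = f x) ->
  computable f.
Proof.
move=> he; split=> ls s _ hls; exists (set_reg s e), (cost e).+2 => x m hm.
exists (cost e).+2, (update m s.*2 (eval (cinp x) m e)); split.
- exact: exec_set_reg.
- exact: leq_const_polyb.
- by rewrite update_same; apply: he; case: hm.
- exact: agree_update.
Qed.

Lemma computable_const v : computable (fun _ : X => v).
Proof. exact: (@computable_expr (EConst v)). Qed.

Lemma computable_var j : j < size (cvars X) ->
  computable (nth (fun=> 0) (cvars X) j).
Proof.
move=> hj; split=> ls s hs hls; exists (set_reg s (reg (nth 0 ls j))), 4 => x m hm.
exists 4, (update m s.*2 (m (nth 0 ls j).*2)); split.
- exact: exec_set_reg.
- exact: leq_const_polyb.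
- by rewrite update_same; apply hm; rewrite hs.
- exact: agree_update.
Qed.

Lemma computable_op1 (op : expr -> expr) (phi : X -> nat -> nat) f :
  (forall r, cost (op (reg r)) <= 10) ->
  (forall x e m, (forall a, m a.*2.+1 = cheap x a) ->
     eval (cinp x) m (op e) = phi x (eval (cinp x) m e)) ->
  computable f -> computable (fun x => phi x (f x)).
Proof.
move=> hc he [hf]; split=> ls s hs hls; have [c [K H]] := hf ls s hs hls.
exists (CSeq c (set_reg s (op (reg s)))), (K + 13) => x m hm.
have [t [m' [h1 h2 h3 h4]]] := H x m hm.
eexists; eexists; split.
- exact: exec_Seq h1 (exec_set_reg _ _ _ _).
- apply: leq_trans (polybD _ _ _).
  by have := leq_const_polyb 13 (cbound x); have := hc s; rewrite /=; lia.
- rewrite update_same he /= ?h3 //.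
  by have [] := stores_agree hls h4 hm.
- exact: agree_trans h4 (agree_update _ _ _).
Qed.

Lemma computable_op2 (op : expr -> expr -> expr) (phi : nat -> nat -> nat) f g :
  (forall r r', cost (op (reg r) (reg r')) <= 10) ->
  (forall inp m e e', eval inp m (op e e') = phi (eval inp m e) (eval inp m e')) ->
  computable f -> computable g -> computable (fun x => phi (f x) (g x)).
Proof.
move=> hc he [hf] [hg]; split=> ls s hs hls; have [c [K H]] := hf ls s hs hls.
have [c' [K' H']] := hg ls s.+1 hs (all_regW (leqnSn s) hls).
exists (CSeq c (CSeq c' (set_reg s (op (reg s) (reg s.+1))))), (K + K' + 14).
move=> x m hm; have [t [m' [h1 h2 h3 h4]]] := H x m hm.
have [t' [m'' [k1 k2 k3 k4]]] := H' x m' (stores_agree hls h4 hm).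
eexists; eexists; split.
- exact: exec_Seq h1 (exec_Seq k1 (exec_set_reg _ _ _ _)).
- apply: leq_trans (polybD _ _ _).
  apply: leq_trans (leq_add (polybD _ _ _) (leqnn _)).
  by have := leq_const_polyb 14 (cbound x); have := hc s s.+1; rewrite /=; lia.
- by rewrite update_same he /= k3 k4 ?h3 // ltn_double leqnn.
- apply: agree_trans h4 (agree_trans (agreeW (leqnSn s) k4) _).
  exact: agree_update.
Qed.

Lemma computable_input f : computable f ->
  computable (fun x => nth 0 (cinp x) (f x)).
Proof. exact: (@computable_op1 EInput (fun x => nth 0 (cinp x))). Qed.

Lemma computable_heap f : computable f -> computable (fun x => cheap x (f x)).
Proof.
apply: (@computable_op1 (fun e => ELoad (EAdd (EConst 1) (EAdd e e)))) => //.
by move=> x e m h /=; rewrite add1n addnn h.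
Qed.

Lemma computable_add f g : computable f -> computable g ->
  computable (fun x => f x + g x).
Proof. exact: (@computable_op2 EAdd addn). Qed.

Lemma computable_sub f g : computable f -> computable g ->
  computable (fun x => f x - g x).
Proof. exact: (@computable_op2 ESub subn). Qed.

Lemma computable_if (b : X -> bool) f g :
  computable (fun x => b x) -> computable f -> computable g ->
  computable (fun x => if b x then f x else g x).
Proof.
move=> [hb] [hf] [hg]; split=> ls s hs hls; have [cb [Kb Hb]] := hb ls s hs hls.
have [c1 [K1 H1]] := hf ls s hs hls; have [c2 [K2 H2]] := hg ls s hs hls.
exists (CSeq cb (CIf (reg s) c1 c2)), (Kb + (K1 + K2) + 4) => x m hm.
have [t [m' [h1 h2 h3 h4]]] := Hb x m hm.
have hm' := stores_agree hls h4 hm.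
have hK : polyb Kb (cbound x) + (polyb K1 (cbound x) + polyb K2 (cbound x)) + 4
    <= polyb (Kb + (K1 + K2) + 4) (cbound x).
  apply: leq_trans (polybD _ _ _); apply: leq_add (leq_const_polyb _ _).
  by apply: leq_trans (polybD _ _ _); rewrite leq_add2l polybD.
case hbx : (b x) h3 => h3.
  have [t1 [m1 [k1 k2 k3 k4]]] := H1 x m' hm'.
  exists (t + (2 + t1).+1).+1, m1; split => //; first last.
  + exact: agree_trans h4 k4.
  + by lia.
  by apply: exec_Seq h1 _; apply: exec_IfT k1; rewrite /= h3.
have [t1 [m1 [k1 k2 k3 k4]]] := H2 x m' hm'.
exists (t + (2 + t1).+1).+1, m1; split => //; first last.
+ exact: agree_trans h4 k4.
+ by lia.
by apply: exec_Seq h1 _; apply: exec_IfF k1; rewrite /= h3.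
Qed.

End Closure.

Arguments computable_const : clear implicits.

(** * Bounded loops *)

Section Iteration.
Variables (X : ctx) (b : X -> nat).

(** The loop index is an ordinal, so that the body is compiled only for indices in range; the bounds
    by [cbound] that inner operations ask for can then be read off the type. *)
Definition ext_sort := {x : X & ('I_(b x) * nat)%type}.
Definition ext_idx (y : ext_sort) : nat := (tagged y).1.
Definition ext_acc (y : ext_sort) : nat := (tagged y).2.

Definition ext : ctx :=
  @Ctx ext_sort (fun y => cinp (tag y)) (fun y => cheap (tag y))
    (fun y => cbound (tag y))
    [:: ext_acc, ext_idx & [seq (fun y : ext_sort => f (tag y)) | f <- cvars X]].

Lemma computable_weaken (f : X -> nat) :
  computable f -> @computable ext (fun y => f (tag y)).
Proof.
move=> [hf]; split=> ls s hs hls.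
have hs' : size (drop 2 ls) = size (cvars X).
  by rewrite size_drop hs /= size_map; lia.
have hls' : all (fun r => r < s) (drop 2 ls).
  by apply/allP => r /mem_drop /(allP hls).
have [c [K H]] := hf _ s hs' hls'; exists c, K => y m [hm1 hm2].
apply: (H (tag y)); split=> // j; rewrite hs' => hj.
rewrite nth_drop hm1; last by rewrite hs /= size_map; lia.
by rewrite add2n /= (nth_map (fun=> 0)).
Qed.

Lemma computable_idx : @computable ext ext_idx.
Proof. exact: (@computable_var ext 1). Qed.

Lemma computable_acc : @computable ext ext_acc.
Proof. exact: (@computable_var ext 0). Qed.

Hypothesis hb : computable b.
Hypothesis b_bound : forall x, b x <= cbound x.

(** Registers s, s.+1, s.+2 and s.+3 hold the accumulator, the number of rounds, the round index and
    the value of the body. By [b_bound], [polybM] pays for all rounds. *)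
Lemma computable_iteri (f0 : X -> nat) (f : X -> nat -> nat -> nat) :
  computable f0 ->
  @computable ext (fun y => f (tag y) (ext_idx y) (ext_acc y)) ->
  computable (fun x => iteri (b x) (f x) (f0 x)).
Proof.
move=> [hf0] [hf]; split=> ls s hs hls; have [c0 [K0 H0]] := hf0 ls s hs hls.
case: hb => hb'; have [cb [Kb Hb]] := hb' ls s.+1 hs (all_regW (leqnSn s) hls).
have hs3 : s <= s.+3 by lia.
have [cf [Kf Hf]] : exists (c : cmd) (K : nat), forall (y : ext) m,
    stores (s :: s.+2 :: ls) y m -> exists t m', [/\ exec (cinp y) c m t m',
      t <= polyb K (cbound y), m' s.+3.*2 = f (tag y) (ext_idx y) (ext_acc y)
      & agree s.+3 m m'].
  apply: hf; first by rewrite /= hs size_map.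
  by rewrite /= (all_regW hs3 hls); lia.
pose body := CSeq cf (CSeq (set_reg s (reg s.+3))
                           (set_reg s.+2 (EAdd (reg s.+2) (EConst 1)))).
pose guard := ESub (reg s.+1) (reg s.+2).
pose loop := CWhile guard body.
exists (CSeq c0 (CSeq cb (CSeq (set_reg s.+2 (EConst 0)) loop))).
exists (K0 + Kb + (Kf + 30).+1 + 30) => x m hm.
have Hloop j i m1 : i + j = b x -> stores ls x m1 ->
    m1 s.*2 = iteri i (f x) (f0 x) -> m1 s.+1.*2 = b x -> m1 s.+2.*2 = i ->
    exists t m2, [/\ exec (cinp x) loop m1 t m2,
      t <= j * (polyb Kf (cbound x) + 30) + 10,
      m2 s.*2 = iteri (b x) (f x) (f0 x) & agree s m1 m2].
  elim: j i m1 => [|j IH] i m1 hij hm1 ha hbd hi.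
    exists 6, m1; split=> //; last by rewrite ha -hij addn0.
    by apply: exec_WhileF; rewrite /= hbd hi -hij; lia.
  have hib : i < b x by lia.
  pose y : ext := Tagged (fun x => ('I_(b x) * nat)%type)
    (Ordinal hib, iteri i (f x) (f0 x)).
  have [t [m2 [h1 h2 h3 h4]]] : exists t m', [/\ exec (cinp x) cf m1 t m',
      t <= polyb Kf (cbound x), m' s.+3.*2 = f x i (iteri i (f x) (f0 x))
      & agree s.+3 m1 m'].
    apply: (Hf y); split; last by case: hm1.
    case=> [|[|k]] //= hk; rewrite (nth_map (fun=> 0)) -?hs //.
    by case: hm1 => -> .
  pose m3 := update m2 s.*2 (m2 s.+3.*2).
  pose m4 := update m3 s.+2.*2 (m3 s.+2.*2 + 1).
  have hag : agree s m1 m4.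
    have h23 : agree s m2 m3 by apply: agree_update.
    have h34 : agree s m3 m4 by apply: agree_update; lia.
    exact: agree_trans (agreeW hs3 h4) (agree_trans h23 h34).
  have e3 : m3 s.+2.*2 = i.
    by rewrite /m3 update_reg ?h4 ?hi // ?ltn_double; lia.
  have [t5 [m5 [k1 k2 k3 k4]]] : exists t m2, [/\ exec (cinp x) loop m4 t m2,
      t <= j * (polyb Kf (cbound x) + 30) + 10,
      m2 s.*2 = iteri (b x) (f x) (f0 x) & agree s m4 m2].
    apply: (IH i.+1); first by lia.
    + exact: stores_agree hls hag hm1.
    + by rewrite /m4 update_reg ?/m3 ?update_same //; lia.
    + rewrite /m4 update_reg ?/m3 ?update_reg ?h4 ?ltn_double //; lia.
    + by rewrite /m4 update_same e3 addn1.
  exists (5 + (t + (4 + 6).+1).+1 + t5).+1, m5; split=> //.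
  + apply: exec_WhileT k1; first by rewrite /= hbd hi; lia.
    apply: exec_Seq h1 _; apply: exec_Seq; exact: exec_set_reg.
  + by rewrite mulSn; lia.
  + exact: agree_trans hag k4.
have [t0 [m0 [h1 h2 h3 h4]]] := H0 x m hm.
have hm0 := stores_agree hls h4 hm.
have [t1 [m1 [k1 k2 k3 k4]]] := Hb x m0 hm0.
have k4' := agreeW (leqnSn s) k4.
have hm1 := stores_agree hls k4' hm0.
pose m2 := update m1 s.+2.*2 0.
have hag : agree s m1 m2 by apply: agree_update; lia.
have [t3 [m3 [l1 l2 l3 l4]]] : exists t m', [/\ exec (cinp x) loop m2 t m',
      t <= b x * (polyb Kf (cbound x) + 30) + 10,
      m' s.*2 = iteri (b x) (f x) (f0 x) & agree s m2 m'].
  apply: (Hloop _ 0) => //.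
  + exact: stores_agree hls hag hm1.
  + by rewrite /m2 update_reg ?k4 ?h3 ?ltn_double //; lia.
  + by rewrite /m2 update_reg ?k3 //; lia.
  + by rewrite /m2 update_same.
exists (t0 + (t1 + (3 + t3).+1).+1).+1, m3; split=> //.
- apply: exec_Seq h1 (exec_Seq k1 (exec_Seq _ l1)); exact: exec_set_reg.
- have e1 : polyb Kf (cbound x) + 30 <= polyb (Kf + 30) (cbound x).
    by apply: leq_trans (polybD _ _ _); rewrite leq_add2l leq_const_polyb.
  have e2 := polybM (Kf + 30) (b_bound x).
  have e3 := leq_mul (leqnn (b x)) e1.
  apply: leq_trans (polybD _ _ _).
  have := leq_const_polyb 30 (cbound x).
  have := polybD (K0 + Kb) (Kf + 30).+1 (cbound x).
  by have := polybD K0 Kb (cbound x); lia.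
- exact: agree_trans h4 (agree_trans k4' (agree_trans hag l4)).
Qed.

End Iteration.

(** * Arithmetic, Boolean connectives and bounded quantifiers *)

Lemma computable_succ (X : ctx) (f : X -> nat) :
  computable f -> computable (fun x => (f x).+1).
Proof.
move=> hf; apply: (computable_ext _ (computable_add hf (computable_const X 1))).
by move=> x; rewrite addn1.
Qed.

Lemma computable_pred (X : ctx) (f : X -> nat) :
  computable f -> computable (fun x => (f x).-1).
Proof.
move=> hf; apply: (computable_ext _ (computable_sub hf (computable_const X 1))).
by move=> x; rewrite subn1.
Qed.

Lemma computable_negb (X : ctx) (p : X -> bool) : computable (fun x => p x) ->
  computable (fun x => ~~ p x).
Proof.
move=> hp; apply: (computable_ext _ (computable_sub (computable_const X 1) hp)).
by move=> x; case: (p x).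
Qed.

Lemma computable_andb (X : ctx) (p q : X -> bool) : computable (fun x => p x) ->
  computable (fun x => q x) -> computable (fun x => p x && q x).
Proof.
move=> hp hq; apply: (computable_ext _ (computable_if hp hq (computable_const X 0))).
by move=> x; case: (p x).
Qed.

Lemma computable_orb (X : ctx) (p q : X -> bool) : computable (fun x => p x) ->
  computable (fun x => q x) -> computable (fun x => p x || q x).
Proof.
move=> hp hq; apply: (computable_ext _ (computable_if hp (computable_const X 1) hq)).
by move=> x; case: (p x).
Qed.

Lemma computable_implyb (X : ctx) (p q : X -> bool) : computable (fun x => p x) ->
  computable (fun x => q x) -> computable (fun x => p x ==> q x).
Proof.
move=> hp hq; apply: (computable_ext _ (computable_if hp hq (computable_const X 1))).
by move=> x; case: (p x).
Qed.

Lemma computable_ifb (X : ctx) (b p q : X -> bool) :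
  computable (fun x => b x) -> computable (fun x => p x) ->
  computable (fun x => q x) -> computable (fun x => if b x then p x else q x).
Proof.
move=> hb hp hq; apply: (computable_ext _ (computable_if hb hp hq)).
by move=> x; case: (b x).
Qed.

Lemma computable_leq (X : ctx) (f g : X -> nat) : computable f -> computable g ->
  computable (fun x => f x <= g x).
Proof.
move=> hf hg.
apply: (computable_ext _ (computable_sub (computable_const X 1)
  (computable_sub hf hg))).
by move=> x; case: leqP => h /=; lia.
Qed.

Lemma computable_eq (X : ctx) (f g : X -> nat) : computable f -> computable g ->
  computable (fun x => f x == g x).
Proof.
move=> hf hg.
apply: (computable_ext _ (computable_andb (computable_leq hf hg)
  (computable_leq hg hf))).
by move=> x; rewrite eqn_leq.
Qed.

(** Repeated addition: only the factor that counts the rounds must stay below [cbound], the product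
    may exceed it. *)
Lemma computable_mul (X : ctx) (f g : X -> nat) : (forall x, f x <= cbound x) ->
  computable f -> computable g -> computable (fun x => f x * g x).
Proof.
move=> hb hf hg.
apply: (computable_ext _ (computable_iteri hf hb (computable_const X 0)
  (f := fun x _ a => g x + a) _)).
  by move=> x; elim: (f x) => //= k ->; rewrite mulSn.
exact: computable_add (computable_weaken _ hg) (computable_acc _).
Qed.

Lemma computable_exp (X : ctx) (f g : X -> nat) : (forall x, f x <= cbound x) ->
  (forall x, g x <= cbound x) ->
  computable f -> computable g -> computable (fun x => f x ^ g x).
Proof.
move=> hb hb' hf hg.
apply: (computable_ext _ (computable_iteri hg hb' (computable_const X 1)
  (f := fun x _ a => f x * a) _)).
  by move=> x; elim: (g x) => //= k ->; rewrite expnS.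
apply: computable_mul;
  [|exact: computable_weaken hf|exact: computable_acc].
by move=> [x y]; apply: hb.
Qed.

(** The quotient is found by counting the i < f x with i.+1 * g x <= f x. *)
Lemma computable_divn (X : ctx) (f g : X -> nat) : (forall x, f x <= cbound x) ->
  (forall x, 0 < g x) ->
  computable f -> computable g -> computable (fun x => f x %/ g x).
Proof.
move=> hb g0 hf hg.
apply: (computable_ext _ (computable_iteri hf hb (computable_const X 0)
  (f := fun x i a => a + (i.+1 * g x <= f x)) _)).
  move=> x; suff -> k : iteri k (fun i a => a + (i.+1 * g x <= f x)) 0 =
    minn k (f x %/ g x) by apply/minn_idPr/leq_div.
  elim: k => [|k IH]; first by rewrite min0n.
  by rewrite [LHS]/= IH -leq_divRL //; move: (_ %/ _) => d; case: leqP; lia.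
apply: computable_add (computable_acc _) _; apply: computable_leq.
  apply: computable_mul;
    [|exact: computable_succ (computable_idx _)|exact: computable_weaken].
  by case=> x [i a] /=; apply: leq_trans (hb x); apply: ltn_ord.
exact: computable_weaken.
Qed.

Lemma computable_modn (X : ctx) (f g : X -> nat) : (forall x, f x <= cbound x) ->
  (forall x, 0 < g x) ->
  computable f -> computable g -> computable (fun x => f x %% g x).
Proof.
move=> hb g0 hf hg.
apply: (computable_ext (f := fun x => f x - f x %/ g x * g x)).
  by move=> x; rewrite {1}(divn_eq (f x) (g x)) addnC addnK.
apply: (computable_sub hf); apply: computable_mul => //.
  by move=> x; apply: leq_trans (leq_div _ _) (hb x).
exact: computable_divn.
Qed.

Lemma computable_has (X : ctx) (b : X -> nat) (p : X -> nat -> bool) :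
  computable b -> (forall x, b x <= cbound x) ->
  @computable (ext b) (fun y => p (tag y) (ext_idx y)) ->
  computable (fun x => has (p x) (iota 0 (b x))).
Proof.
move=> hb hbd hp.
apply: (computable_ext _ (computable_iteri hb hbd (computable_const X 0)
  (f := fun x i a => (a != 0) || p x i) _)).
  move=> x; elim: (b x) => [|k IH] //; rewrite [LHS]/= IH eqb0 negbK.
  by rewrite -(addn1 k) iotaD has_cat /= orbF.
apply: computable_orb hp; apply: computable_negb.
exact: computable_eq (computable_acc _) (computable_const _ _).
Qed.

Lemma computable_all (X : ctx) (b : X -> nat) (p : X -> nat -> bool) :
  computable b -> (forall x, b x <= cbound x) ->
  @computable (ext b) (fun y => p (tag y) (ext_idx y)) ->
  computable (fun x => all (p x) (iota 0 (b x))).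
Proof.
move=> hb hbd hp.
apply: (computable_ext (f := fun x => ~~ has (predC (p x)) (iota 0 (b x)))).
  by move=> x; rewrite has_predC negbK.
apply/computable_negb/(computable_has (p := fun x => predC (p x))) => //.
exact: computable_negb.
Qed.

(** * The dynamic program *)

Definition digit (b x j : nat) := x %/ b ^ j %% b.

Section Program.
Variables (n m : nat) (g : rel nat).

(* A vertex code packs four digits v, x, p, s in base n.+1: the vertex v lies on
   the path starting at x, where p precedes and s follows v; p = v at the start
   and s = v at the end of a path. The digit v = n stands for no vertex. *)
Definition code_base := n.+1 ^ 4.
Definition code_vertex q := digit n.+1 q 0.
Definition code_start q := digit n.+1 q 1.
Definition code_pred q := digit n.+1 q 2.
Definition code_succ q := digit n.+1 q 3.

(* A bag packs m.+1 vertex codes; the one at position 0 is its head. *)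
Definition bag_bound := code_base ^ m.+1.
Definition bag_code Z j := digit code_base Z j.
Definition bag_vertex Z j := code_vertex (bag_code Z j).
Definition in_bag Z u := has (fun j => bag_vertex Z j == u) (iota 0 m.+1).
Definition in_tail Z u := has (fun j => bag_vertex Z j.+1 == u) (iota 0 m).
(** The largest bag code has only maximal digits, so every vertex digit in it is n and stands for no
    vertex. *)
Definition empty_bag := bag_bound.-1.

Definition reach_base i u Z := [&& i == u, u < n & ~~ in_bag Z u].

Definition reach_step (R : nat -> bool) u Z :=
  R u || [&& u < n, ~~ in_bag Z u & has (fun v => R v && g v u) (iota 0 n)].

(** Walks with at most s edges that avoid the bag. They serve twice: for s = n they describe the
    components left by Z, and for the empty bag they measure distances. *)
Fixpoint reach s i u Z :=
  if s is s'.+1 then reach_step (fun v => reach s' i v Z) u Z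
  else reach_base i u Z.

Definition is_start q := code_pred q == code_vertex q.

Definition compatible q q' :=
  ((code_pred q == code_vertex q') && (code_vertex q' != code_vertex q) ==>
    (code_start q' == code_start q) && (code_succ q' == code_vertex q)) &&
  ((code_succ q == code_vertex q') && (code_vertex q' != code_vertex q) ==>
    (code_start q' == code_start q) && (code_pred q' == code_vertex q)).

Definition consistent Z :=
  all (fun j => all (fun j' => (bag_vertex Z j == bag_vertex Z j') ==>
    (bag_code Z j == bag_code Z j')) (iota 0 m.+1)) (iota 0 m.+1).

Section Oracle.
(** R plays the role of [reach]: it is [ranged_reach] in the specification and the lookup
    [heap_reach] on the machine. *)
Variable R : nat -> nat -> nat -> nat -> bool.

(** Some radius s separates p from v, that is, d(x,p) < d(x,v). Along an edge between p and v this
    means d(x,v) = d(x,p) + 1. *)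
Definition closer x p v :=
  has (fun s => R s x p empty_bag && ~~ R s x v empty_bag) (iota 0 n).

Definition admissible q :=
  ((is_start q && (code_start q == code_vertex q)) ||
   (g (code_pred q) (code_vertex q) &&
    closer (code_start q) (code_pred q) (code_vertex q))) &&
  ((code_succ q == code_vertex q) || g (code_vertex q) (code_succ q)).

(** A missing head counts as adjacent to everything, so that below the empty bag the whole graph is
    treated. *)
Definition touches Z i :=
  has (fun u => R n i u Z && ((bag_vertex Z 0 == n) || g u (bag_vertex Z 0)))
    (iota 0 n).

Definition fresh Z i :=
  touches Z i && ~~ has (fun i' => (i' < i) && R n i' i Z) (iota 0 n).

Definition tail_codes_in Z Z' :=
  all (fun j => has (fun j' => bag_code Z' j.+1 == bag_code Z j')
    (iota 0 m.+1)) (iota 0 m).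

Definition boundary_in_tail Z i Z' :=
  all (fun u => R n i u Z ==> all (fun z => g u z ==>
    (R n i z Z || in_tail Z' z)) (iota 0 n)) (iota 0 n).

(** Only the head of the new bag is checked. Tail codes are inherited from Z, and the other vertices
    of the component become heads further down; an edge from the present head to one of them is
    checked there, the present head then being in the tail. *)
Definition link Z i Z' :=
  [&& R n i (bag_vertex Z' 0) Z, admissible (bag_code Z' 0),
      all (fun j => compatible (bag_code Z' 0) (bag_code Z' j.+1) &&
                    compatible (bag_code Z' j.+1) (bag_code Z' 0)) (iota 0 m),
      tail_codes_in Z Z' & boundary_in_tail Z i Z'].

Definition table_step s i Z c (T : nat -> bool) (T' : nat -> nat -> bool) :=
  if fresh Z i then
    (0 < s) && has (fun c1 => T c1 && has (fun c2 =>
      has (fun Z' => [&& T' c2 Z', c1 + c2 + is_start (bag_code Z' 0) == c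
                       & link Z i Z'])
        (iota 0 bag_bound)) (iota 0 n.+1)) (iota 0 n.+1)
  else T c.

Definition table_base Z c := (c == 0) && consistent Z.

(* The components of the graph without Z that touch the head of Z and contain a
   vertex below i have a valid labelling that extends Z and has c path starts,
   with bags nested at most s deep. *)
Fixpoint table s := fix aux i Z c : bool :=
  if i is i'.+1 then
    table_step s i' Z c (fun c1 => aux i' Z c1)
      (fun c2 Z' => if s is s'.+1 then table s' n Z' c2 else false)
  else table_base Z c.

End Oracle.

Definition in_range s i u Z :=
  [&& s < bag_bound, i < bag_bound, u < bag_bound & Z < bag_bound].

(** Five digits in base [bag_bound], from the most significant k down to Z. In this order every cell
    depends only on smaller addresses: [table] on [reach], a round on the previous one, an index on
    the preceding index. One pass in increasing order thus fills the heap. *)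
Definition addr k s i c Z :=
  bag_bound * (bag_bound * (bag_bound * (bag_bound * k + s) + i) + c) + Z.

(** The range test prevents an argument too large for its digit from being read as a different cell.
    [ranged_reach] repeats the test, which makes the two agree on all arguments. *)
Definition heap_reach (h : nat -> nat) s i u Z :=
  in_range s i u Z && (h (addr 0 s i u Z) != 0).

Definition ranged_reach s i u Z := in_range s i u Z && reach s i u Z.

(* Cells of kind 0 hold reach, all others hold table. *)
Definition addr_kind a := digit bag_bound a 4.
Definition addr_round a := digit bag_bound a 3.
Definition addr_idx a := digit bag_bound a 2.
Definition addr_val a := digit bag_bound a 1.
Definition addr_bag a := digit bag_bound a 0.

Definition cell (a : nat) : bool :=
  if addr_kind a == 0 then
    reach (addr_round a) (addr_idx a) (addr_val a) (addr_bag a)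
  else table ranged_reach (addr_round a) (addr_idx a) (addr_bag a) (addr_val a).

Definition cell_step (h : nat -> nat) (a : nat) : bool :=
  if addr_kind a == 0 then
    if addr_round a == 0 then reach_base (addr_idx a) (addr_val a) (addr_bag a)
    else reach_step
      (fun v => heap_reach h (addr_round a).-1 (addr_idx a) v (addr_bag a))
      (addr_val a) (addr_bag a)
  else
    if addr_idx a == 0 then table_base (addr_bag a) (addr_val a)
    else table_step (heap_reach h) (addr_round a) (addr_idx a).-1
      (addr_bag a) (addr_val a)
      (fun c1 => h (addr 1 (addr_round a) (addr_idx a).-1 c1 (addr_bag a)) != 0)
      (fun c2 Z' => h (addr 1 (addr_round a).-1 n c2 Z') != 0).

Definition cell_count := bag_bound ^ 5.

(** * Digits and addresses *)

Lemma code_base_gt0 : 0 < code_base. Proof. by rewrite expn_gt0. Qed.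

Lemma bag_bound_gt0 : 0 < bag_bound.
Proof. by rewrite expn_gt0 code_base_gt0. Qed.

Lemma leq_code_bag_bound : code_base <= bag_bound.
Proof. by rewrite /bag_bound expnS leq_pmulr // expn_gt0 code_base_gt0. Qed.

Lemma ltn_n_code_base : n < code_base.
Proof. by rewrite /code_base expnS leq_pmulr // expn_gt0. Qed.

Lemma ltn_n_bag_bound : n < bag_bound.
Proof. exact: leq_trans ltn_n_code_base leq_code_bag_bound. Qed.

Lemma digit_lt b x j : 0 < b -> digit b x j < b.
Proof. exact: ltn_pmod. Qed.

Lemma digit_top b x j : x < b ^ j.+1 -> digit b x j = x %/ b ^ j.
Proof.
move=> h; have b0 : 0 < b by case: b h => //; rewrite exp0n.
by rewrite /digit modn_small // ltn_divLR ?expn_gt0 ?b0 // -expnS.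
Qed.

Lemma digitM b y z : z < b -> digit b (b * y + z) 0 = z.
Proof. by move=> h; rewrite /digit divn1 mulnC modnMDl modn_small. Qed.

Lemma digitMS b y z j : z < b -> digit b (b * y + z) j.+1 = digit b y j.
Proof.
move=> h; have b0 : 0 < b by apply: leq_ltn_trans h.
by rewrite /digit expnS divnMA mulnC divnMDl // (divn_small h) addn0.
Qed.

Lemma ltn_mulD b x y z z' : z < b -> x < y -> b * x + z < b * y + z'.
Proof.
move=> hz hxy; apply: (@leq_trans (b * x.+1)).
  by rewrite mulnS addnC ltn_add2r.
by apply: leq_trans (leq_addr _ _); rewrite leq_mul2l hxy orbT.
Qed.

Lemma ltn_mulD_exp b x z e : z < b -> x < b ^ e -> b * x + z < b ^ e.+1.
Proof.
by move=> hz hx; rewrite expnS -[ltnRHS]addn0; apply: ltn_mulD.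
Qed.

Lemma addr_eq a : a < cell_count ->
  a = addr (addr_kind a) (addr_round a) (addr_idx a) (addr_val a) (addr_bag a).
Proof.
move=> ha; rewrite /addr /addr_kind digit_top //.
rewrite /addr_round /addr_idx /addr_val /addr_bag /digit.
have E i : bag_bound * (a %/ bag_bound ^ i.+1) + a %/ bag_bound ^ i %% bag_bound
    = a %/ bag_bound ^ i.
  by rewrite expnSr divnMA mulnC -divn_eq.
by rewrite !E expn0 divn1.
Qed.

Lemma addr_lt_kind k s i c Z k' s' i' c' Z' : in_range s i c Z ->
  k < k' -> addr k s i c Z < addr k' s' i' c' Z'.
Proof.
move=> /and4P[hs hi hc hZ] hk; rewrite /addr.
by do 4!apply: ltn_mulD => //.
Qed.

Lemma addr_lt_round k s i c Z s' i' c' Z' : in_range s i c Z ->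
  s < s' -> addr k s i c Z < addr k s' i' c' Z'.
Proof.
move=> /and4P[_ hi hc hZ] hs; rewrite /addr.
by do 3!apply: ltn_mulD => //; rewrite ltn_add2l.
Qed.

Lemma addr_lt_idx k s i c Z i' c' Z' : in_range s i c Z ->
  i < i' -> addr k s i c Z < addr k s i' c' Z'.
Proof.
move=> /and4P[_ _ hc hZ] hs; rewrite /addr.
by do 2!apply: ltn_mulD => //; rewrite ltn_add2l.
Qed.

Lemma addr_lt k s i c Z : in_range s i c Z -> k < bag_bound ->
  addr k s i c Z < cell_count.
Proof.
move=> /and4P[hs hi hc hZ] hk; rewrite /addr /cell_count.
by do 3!apply: ltn_mulD_exp => //; apply: (@ltn_mulD_exp _ _ _ 1).
Qed.

Lemma addrK k s i c Z : in_range s i c Z -> k < bag_bound ->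
  [/\ addr_kind (addr k s i c Z) = k, addr_round (addr k s i c Z) = s,
      addr_idx (addr k s i c Z) = i, addr_val (addr k s i c Z) = c &
      addr_bag (addr k s i c Z) = Z].
Proof.
move=> /and4P[hs hi hc hZ] hk.
rewrite /addr_kind /addr_round /addr_idx /addr_val /addr_bag /addr.
rewrite !digitMS ?digitM // /digit divn1 modn_small //.
Qed.

Lemma tableS R s i Z c : table R s i.+1 Z c =
  table_step R s i Z c (fun c1 => table R s i Z c1)
    (fun c2 Z' => if s is s'.+1 then table R s' n Z' c2 else false).
Proof. by case: s. Qed.

Lemma table0 R s Z c : table R s 0 Z c = table_base Z c.
Proof. by case: s. Qed.

Lemma eq_table_step R s i Z c T U T' U' :
  (forall c1, c1 < bag_bound -> T c1 = U c1) -> c < bag_bound ->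
  (0 < s -> forall c2 Z', c2 < bag_bound -> Z' < bag_bound ->
     T' c2 Z' = U' c2 Z') ->
  table_step R s i Z c T T' = table_step R s i Z c U U'.
Proof.
move=> hT hc hT'; rewrite /table_step hT //; case: fresh => //.
case: posnP => // s0; rewrite !andTb; apply: eq_in_has => c1; rewrite mem_iota => h1.
have hn (c0 : nat) : c0 < n.+1 -> c0 < bag_bound.
  by move=> h; apply: leq_ltn_trans ltn_n_bag_bound.
rewrite hT ?hn //; congr andb; apply: eq_in_has => c2.
rewrite mem_iota => h2; apply: eq_in_has => Z'.
by rewrite mem_iota => h3; rewrite hT' // hn.
Qed.

Lemma cell_step_correct (h : nat -> nat) a : a < cell_count ->
  (forall a0, a0 < a -> h a0 = cell a0) -> cell_step h a = cell a.
Proof.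
move=> ha hh; have N0 := bag_bound_gt0.
have lt_s : addr_round a < bag_bound by apply: digit_lt.
have lt_i : addr_idx a < bag_bound by apply: digit_lt.
have lt_c : addr_val a < bag_bound by apply: digit_lt.
have lt_Z : addr_bag a < bag_bound by apply: digit_lt.
have lt_k : addr_kind a < bag_bound by apply: digit_lt.
have ea := addr_eq ha; rewrite /cell_step /cell; move: lt_s lt_i lt_c lt_Z lt_k ea.
move: (addr_kind a) (addr_round a) (addr_idx a) (addr_val a) (addr_bag a).
move=> k s i c Z lt_s lt_i lt_c lt_Z lt_k ea.
case: eqVneq => [k0|k_neq0].
  case: s lt_s ea => [|s] //= lt_s ea.
  have E v : heap_reach h s i v Z = ranged_reach s i v Z.
    rewrite /heap_reach /ranged_reach; case hr: in_range => //=.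
    have [e1 e2 e3 e4 e5] := addrK hr N0.
    rewrite hh ?eqb0 ?negbK /cell ?e1 ?e2 ?e3 ?e4 ?e5 //.
    by rewrite ea k0; apply: addr_lt_round.
  have E' v : v < bag_bound -> heap_reach h s i v Z = reach s i v Z.
    by move=> hv; rewrite E /ranged_reach /in_range (ltnW lt_s) lt_i hv lt_Z.
  rewrite /reach_step E' //; congr (_ || [&& _, _ & _]); apply: eq_in_has => v.
  by rewrite mem_iota => /= hv; rewrite E' // (ltn_trans hv ltn_n_bag_bound).
have k_gt0 : 0 < k by rewrite lt0n.
have E : heap_reach h = ranged_reach.
  apply/funext => s'; apply/funext => i'; apply/funext => v; apply/funext => Y.
  rewrite /heap_reach /ranged_reach; case hr: in_range => //=.
  have [e1 e2 e3 e4 e5] := addrK hr N0.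
  rewrite hh ?eqb0 ?negbK /cell ?e1 ?e2 ?e3 ?e4 ?e5 //.
  by rewrite ea; apply: addr_lt_kind.
case: i lt_i ea => [|i] /= lt_i ea; first by rewrite table0.
rewrite tableS E; have N1 : 1 < bag_bound by apply: leq_ltn_trans lt_k.
have rd s' i' c' Y : in_range s' i' c' Y -> addr 1 s' i' c' Y < a ->
    (h (addr 1 s' i' c' Y) != 0) = table ranged_reach s' i' Y c'.
  move=> hr hlt; have [e1 e2 e3 e4 e5] := addrK hr N1.
  by rewrite hh // eqb0 negbK /cell e1 e2 e3 e4 e5.
apply: eq_table_step => // [c1 h1|s0 c2 Y h2 hY].
  have hr : in_range s i c1 Z by apply/and4P; split=> //; apply: ltnW.
  (* A cell of kind 1 reads its own kind at a smaller index; higher kinds read kind 1, which lies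
     entirely below them. *)
  rewrite rd // ea; move: k_gt0; rewrite leq_eqVlt => /orP[/eqP<-|k1].
    exact: addr_lt_idx.
  exact: addr_lt_kind.
case: s s0 lt_s ea => //= s _ lt_s ea.
have hr : in_range s n c2 Y.
  by apply/and4P; split=> //; [apply: ltnW | apply: ltn_n_bag_bound].
rewrite rd // ea; move: k_gt0; rewrite leq_eqVlt => /orP[/eqP<-|k1].
  exact: addr_lt_round.
exact: addr_lt_kind.
Qed.

End Program.

(** * The dynamic program on the machine *)

(** In [encode] the order, k and the number of edges come first, so that edge e occupies positions 3
    + 2e and 4 + 2e. *)
Definition input_adj (inp : seq nat) (u v : nat) : bool :=
  has (fun e =>
    ((nth 0 inp (3 + (e + e)) == u) && (nth 0 inp (4 + (e + e)) == v)) ||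
    ((nth 0 inp (3 + (e + e)) == v) && (nth 0 inp (4 + (e + e)) == u)))
    (iota 0 (nth 0 inp 2)).

Notation vcount x := (nth 0 (cinp x) 0).

(** What all loop bounds of the dynamic program follow from. It passes to the context of a loop body
    by [sized_ext]. A positive order makes [code_base] at least 16, which puts digit positions and
    small constants below [cbound]. *)
Record sized (X : ctx) (fm : X -> nat) : Prop := Sized {
  sized_comp : computable fm;
  sized_order : forall x : X, 0 < vcount x;
  sized_edges : forall x : X, nth 0 (cinp x) 2 <= cbound x;
  sized_cells : forall x : X, cell_count (vcount x) (fm x) <= cbound x }.

Lemma sized_ext (X : ctx) (fm b : X -> nat) : sized fm ->
  @sized (ext b) (fun y => fm (tag y)).
Proof.
move=> [h1 h2 h3 h4]; split=> [|[x y]|[x y]|[x y]].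
- exact: computable_weaken.
- exact: h2.
- exact: h3.
- exact: h4.
Qed.

Ltac weakened H :=
  first [ exact: H
        | exact: (computable_weaken _ H)
        | exact: (computable_weaken _ (computable_weaken _ H))
        | exact: (computable_weaken _ (computable_weaken _ (computable_weaken _ H)))
        | exact: (computable_weaken _ (computable_weaken _ (computable_weaken _
                   (computable_weaken _ H)))) ].

Ltac comp_leaf :=
  match goal with
  | H : computable _ |- _ => weakened H
  | |- computable ?f =>
      first [ exact: computable_const | exact: computable_idx
            | exact: (computable_weaken _ (computable_idx _))
            | exact: (computable_weaken _ (computable_weaken _ (computable_idx _)))
            | exact: (computable_weaken _ (computable_weaken _
                       (computable_weaken _ (computable_idx _)))) ]
  end.

Ltac comp_step :=
  lazymatch goal with
  | |- computable (fun x => nat_of_bool (_ && _)) => apply: computable_andb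
  | |- computable (fun x => nat_of_bool (_ || _)) => apply: computable_orb
  | |- computable (fun x => nat_of_bool (_ ==> _)) => apply: computable_implyb
  | |- computable (fun x => nat_of_bool (~~ _)) => apply: computable_negb
  | |- computable (fun x => nat_of_bool (_ == _)) => apply: computable_eq
  | |- computable (fun x => nat_of_bool (_ <= _)) => apply: computable_leq
  | |- computable (fun x => _ + _) => apply: computable_add
  | |- computable (fun x => nth 0 (cinp _) _) => apply: computable_input
  | |- computable (fun x => S _) => apply: computable_succ
  | |- computable (fun x => predn _) => apply: computable_pred
  | |- computable _ => comp_leaf
  end.

Section Bounds.
Variables (X : ctx) (fm : X -> nat) (W : sized fm).

Lemma code_base_ge16 (x : X) : 16 <= code_base (vcount x).
Proof. by rewrite (@leq_exp2r 2 (vcount x).+1 4) // ltnS (sized_order W). Qed.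

Lemma bag_bound_le (x : X) : bag_bound (vcount x) (fm x) <= cbound x.
Proof.
apply: leq_trans (sized_cells W x); rewrite /cell_count expnS leq_pmulr //.
by rewrite expn_gt0 bag_bound_gt0.
Qed.

Lemma ltn_fm_bag_bound (x : X) : (fm x).+1 < bag_bound (vcount x) (fm x).
Proof. by apply: ltn_expl; apply: leq_trans (code_base_ge16 x). Qed.

Lemma ltn_fm_bound (x : X) : (fm x).+1 < cbound x.
Proof. exact: leq_trans (ltn_fm_bag_bound x) (bag_bound_le x). Qed.

Lemma code_base_bound (x : X) : code_base (vcount x) <= cbound x.
Proof. exact: leq_trans (leq_code_bag_bound _ _) (bag_bound_le x). Qed.

Lemma bound_ge16 (x : X) : 16 <= cbound x.
Proof. exact: leq_trans (code_base_ge16 x) (code_base_bound x). Qed.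

Lemma ltn_order_bound (x : X) : vcount x < cbound x.
Proof. exact: leq_trans (ltn_n_code_base _) (code_base_bound x). Qed.
End Bounds.

Section Fields.
Variables (X : ctx) (fm : X -> nat) (W : sized fm).
Implicit Types (f fq fZ fu fj : X -> nat).

Lemma computable_order : computable (fun x : X => vcount x).
Proof. by repeat comp_step. Qed.

Lemma computable_digit fb fx fj : (forall x, 0 < fb x) ->
  (forall x, fb x <= cbound x) -> (forall x, fx x <= cbound x) ->
  (forall x, fj x <= cbound x) ->
  computable fb -> computable fx -> computable fj ->
  computable (fun x => digit (fb x) (fx x) (fj x)).
Proof.
move=> b0 hb hx hj cb cx cj; apply: computable_modn => //.
  by move=> x; apply: leq_trans (leq_div _ _) (hx x).
apply: computable_divn => //; first by move=> x; rewrite expn_gt0 b0.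
exact: computable_exp.
Qed.

Lemma computable_code_digit fq j : j <= 3 -> computable fq ->
  (forall x, fq x <= cbound x) ->
  computable (fun x => digit (vcount x).+1 (fq x) j).
Proof.
move=> hj cq hq; apply: computable_digit => // [x|x||].
- exact: (ltn_order_bound W).
- by apply: leq_trans (bound_ge16 W x); apply: leq_trans hj _.
- exact/computable_succ/computable_order.
- exact: computable_const.
Qed.

Lemma computable_code_base : computable (fun x : X => code_base (vcount x)).
Proof.
apply: computable_exp => [x|x||]; last exact: computable_const.
- exact: (ltn_order_bound W).
- by apply: leq_trans (bound_ge16 W x).
- exact/computable_succ/computable_order.
Qed.

Lemma computable_bag_bound :
  computable (fun x => bag_bound (vcount x) (fm x)).
Proof.
apply: computable_exp => [x|x||].
- exact: (code_base_bound W).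
- exact/ltnW/(ltn_fm_bound W).
- exact: computable_code_base.
- exact/computable_succ/(sized_comp W).
Qed.

Lemma computable_bag_code fZ fj : computable fZ -> computable fj ->
  (forall x, fZ x <= cbound x) -> (forall x, fj x <= cbound x) ->
  computable (fun x => bag_code (vcount x) (fZ x) (fj x)).
Proof.
move=> cZ cj hZ hj; apply: computable_digit => // [x|].
- exact: (code_base_bound W).
- exact: computable_code_base.
Qed.

Lemma bag_code_bound fZ fj x : bag_code (vcount x) (fZ x) (fj x) <= cbound x.
Proof.
apply: leq_trans (code_base_bound W x).
by apply/ltnW/digit_lt/code_base_gt0.
Qed.

Lemma computable_bag_vertex fZ fj : computable fZ -> computable fj ->
  (forall x, fZ x <= cbound x) -> (forall x, fj x <= cbound x) ->
  computable (fun x => bag_vertex (vcount x) (fZ x) (fj x)).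
Proof.
move=> cZ cj hZ hj; apply: (@computable_code_digit _ 0) => // [|x].
  exact: computable_bag_code.
exact: bag_code_bound.
Qed.

Lemma computable_compatible fq fq' : computable fq -> computable fq' ->
  (forall x, fq x <= cbound x) -> (forall x, fq' x <= cbound x) ->
  computable (fun x => compatible (vcount x) (fq x) (fq' x)).
Proof.
move=> cq cq' hq hq'; rewrite /compatible.
have dq j : j <= 3 -> computable (fun x => digit (vcount x).+1 (fq x) j).
  by move=> hj; apply: computable_code_digit.
have dq' j : j <= 3 -> computable (fun x => digit (vcount x).+1 (fq' x) j).
  by move=> hj; apply: computable_code_digit.
by repeat first [apply: dq | apply: dq' | comp_step].
Qed.

Lemma computable_adj fu fv : computable fu -> computable fv ->
  computable (fun x => input_adj (cinp x) (fu x) (fv x)).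
Proof.
move=> cu cv; apply: computable_has; [by repeat comp_step|exact: sized_edges W|].
by repeat comp_step.
Qed.

End Fields.

Lemma computable_in_bag (X : ctx) (fm fZ fu : X -> nat) : sized fm ->
  computable fZ -> computable fu -> (forall x, fZ x <= cbound x) ->
  computable (fun x => in_bag (vcount x) (fm x) (fZ x) (fu x)).
Proof.
move=> W cZ cu hZ; have cm := sized_comp W.
apply: computable_has; first by repeat comp_step.
  by move=> x; apply/ltnW/(ltn_fm_bound W).
apply: computable_eq; last by comp_leaf.
apply: (computable_bag_vertex (sized_ext _ W)); try by comp_leaf.
  by move=> y; apply: hZ.
move=> y; apply: leq_trans (ltnW (ltn_ord _)) (ltnW (ltn_fm_bound W _)).
Qed.

Lemma computable_in_tail (X : ctx) (fm fZ fu : X -> nat) : sized fm ->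
  computable fZ -> computable fu -> (forall x, fZ x <= cbound x) ->
  computable (fun x => in_tail (vcount x) (fm x) (fZ x) (fu x)).
Proof.
move=> W cZ cu hZ; have cm := sized_comp W.
apply: computable_has; first by repeat comp_step.
  by move=> x; apply/ltnW/ltnW/(ltn_fm_bound W).
apply: computable_eq; last by comp_leaf.
apply: (computable_bag_vertex (sized_ext _ W)); try by repeat comp_step.
by move=> y; apply: leq_trans (ltn_ord _) (ltnW (ltnW (ltn_fm_bound W _))).
Qed.

Lemma computable_addr (X : ctx) (fm fk fs fi fc fZ : X -> nat) : sized fm ->
  computable fk -> computable fs -> computable fi -> computable fc ->
  computable fZ ->
  computable (fun x => addr (vcount x) (fm x) (fk x) (fs x) (fi x) (fc x) (fZ x)).
Proof.
move=> W *; have cN := computable_bag_bound W; have hN := bag_bound_le W.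
rewrite /addr; by repeat first [comp_step | apply: (computable_mul hN)].
Qed.

Lemma computable_heap_reach (X : ctx) (fm fs fi fu fZ : X -> nat) : sized fm ->
  computable fs -> computable fi -> computable fu -> computable fZ ->
  computable (fun x =>
    heap_reach (vcount x) (fm x) (cheap x) (fs x) (fi x) (fu x) (fZ x)).
Proof.
move=> W *; have cN := computable_bag_bound W.
rewrite /heap_reach /in_range.
apply: computable_andb; first by repeat comp_step.
apply: computable_negb; apply: computable_eq; last by comp_leaf.
by apply: computable_heap; apply: computable_addr => //; comp_leaf.
Qed.

Lemma computable_closer (X : ctx) (fm fx fp fv : X -> nat) : sized fm ->
  computable fx -> computable fp -> computable fv ->
  computable (fun x => closer (vcount x) (fm x)
    (heap_reach (vcount x) (fm x) (cheap x)) (fx x) (fp x) (fv x)).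
Proof.
move=> W *; have cN := computable_bag_bound W; have cn := computable_order X.
apply: computable_has => //; first by move=> x; apply/ltnW/(ltn_order_bound W).
have cE : computable (fun x => empty_bag (vcount x) (fm x)).
  exact: computable_pred.
by apply: computable_andb; last apply: computable_negb;
  apply: (computable_heap_reach (sized_ext _ W)); comp_leaf.
Qed.

Lemma computable_admissible (X : ctx) (fm fq : X -> nat) : sized fm ->
  computable fq -> (forall x, fq x <= cbound x) ->
  computable (fun x => admissible (vcount x) (fm x) (input_adj (cinp x))
    (heap_reach (vcount x) (fm x) (cheap x)) (fq x)).
Proof.
move=> W cq hq.
have cd j : j <= 3 -> computable (fun x => digit (vcount x).+1 (fq x) j).
  by move=> hj; apply: (computable_code_digit W).
have c0 := cd 0 isT; have c1 := cd 1 isT; have c2 := cd 2 isT; have c3 := cd 3 isT.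
rewrite /admissible /is_start.
by repeat first [ apply: (computable_adj W) | apply: (computable_closer W)
                | comp_step ].
Qed.

Lemma computable_touches (X : ctx) (fm fZ fi : X -> nat) : sized fm ->
  computable fZ -> computable fi -> (forall x, fZ x <= cbound x) ->
  computable (fun x => touches (vcount x) (input_adj (cinp x))
    (heap_reach (vcount x) (fm x) (cheap x)) (fZ x) (fi x)).
Proof.
move=> W cZ ci hZ; have cn := computable_order X.
have cv : computable (fun x => bag_vertex (vcount x) (fZ x) 0).
  by apply: (computable_bag_vertex W) => //; exact: computable_const.
apply: computable_has => //; first by move=> x; apply/ltnW/(ltn_order_bound W).
apply: computable_andb.
  by apply: (computable_heap_reach (sized_ext _ W)); comp_leaf.
apply: computable_orb; first by apply: computable_eq; comp_leaf.
by apply: (computable_adj (sized_ext _ W)); comp_leaf.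
Qed.

Lemma computable_fresh (X : ctx) (fm fZ fi : X -> nat) : sized fm ->
  computable fZ -> computable fi -> (forall x, fZ x <= cbound x) ->
  computable (fun x => fresh (vcount x) (input_adj (cinp x))
    (heap_reach (vcount x) (fm x) (cheap x)) (fZ x) (fi x)).
Proof.
move=> W cZ ci hZ; have cn := computable_order X.
apply: computable_andb; first exact: computable_touches.
apply/computable_negb/computable_has => //.
  by move=> x; apply/ltnW/(ltn_order_bound W).
apply: computable_andb; first by repeat comp_step.
by apply: (computable_heap_reach (sized_ext _ W)); comp_leaf.
Qed.

Lemma computable_tail_codes_in (X : ctx) (fm fZ fY : X -> nat) : sized fm ->
  computable fZ -> computable fY ->
  (forall x, fZ x <= cbound x) -> (forall x, fY x <= cbound x) ->
  computable (fun x => tail_codes_in (vcount x) (fm x) (fZ x) (fY x)).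
Proof.
move=> W cZ cY hZ hY; have cm := sized_comp W.
have hm x := ltnW (ltn_fm_bound W x).
apply: computable_all => //; first by move=> x; apply/ltnW/hm.
apply: computable_has; first by repeat comp_step.
  by move=> y; apply: hm.
have W2 := sized_ext (fun y : ext fm => (fm (tag y)).+1) (sized_ext fm W).
apply: computable_eq; apply: (computable_bag_code W2);
  try by repeat comp_step.
- by move=> y; apply: leq_trans (ltn_ord _) (ltnW (hm _)).
- by move=> y; apply: leq_trans (ltnW (ltn_ord _)) (hm _).
Qed.

Lemma computable_boundary_in_tail (X : ctx) (fm fZ fi fY : X -> nat) :
  sized fm -> computable fZ -> computable fi -> computable fY ->
  (forall x, fY x <= cbound x) ->
  computable (fun x => boundary_in_tail (vcount x) (fm x) (input_adj (cinp x))
    (heap_reach (vcount x) (fm x) (cheap x)) (fZ x) (fi x) (fY x)).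
Proof.
move=> W cZ ci cY hY; have cn := computable_order X.
have hn x := ltnW (ltn_order_bound W x).
apply: computable_all => //; apply: computable_implyb.
  by apply: (computable_heap_reach (sized_ext _ W)); comp_leaf.
apply: computable_all; [by comp_leaf|by move=> y; apply: hn|].
pose b (x : X) := vcount x.
have W2 := sized_ext (fun y : ext b => b (tag y)) (sized_ext b W).
apply: computable_implyb; first by apply: (computable_adj W2); comp_leaf.
apply: computable_orb.
  by apply: (computable_heap_reach W2); comp_leaf.
apply: (computable_in_tail W2); try by comp_leaf.
by move=> y; apply: hY.
Qed.

Lemma computable_link (X : ctx) (fm fZ fi fY : X -> nat) : sized fm ->
  computable fZ -> computable fi -> computable fY ->
  (forall x, fZ x <= cbound x) -> (forall x, fY x <= cbound x) ->
  computable (fun x => link (vcount x) (fm x) (input_adj (cinp x))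
    (heap_reach (vcount x) (fm x) (cheap x)) (fZ x) (fi x) (fY x)).
Proof.
move=> W cZ ci cY hZ hY; have cn := computable_order X.
have cm := sized_comp W; have c0 := computable_const X 0.
have hm x := ltnW (ltnW (ltn_fm_bound W x)).
have ch : computable (fun x => bag_code (vcount x) (fY x) 0).
  exact: (computable_bag_code W).
have hh x : bag_code (vcount x) (fY x) 0 <= cbound x.
  exact: (bag_code_bound W _ (fun=> 0)).
apply: computable_andb; [|apply: computable_andb; [|apply: computable_andb;
  [|apply: computable_andb]]].
- apply: (computable_heap_reach W) => //.
  exact: (computable_bag_vertex W).
- exact: computable_admissible.
- apply: computable_all => //.
  have W1 := sized_ext fm W.
  have ct : @computable (ext fm)
      (fun y => bag_code (vcount (tag y)) (fY (tag y)) (ext_idx y).+1).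
    apply: (computable_bag_code W1); try by repeat comp_step.
    by move=> y; apply: leq_trans (ltn_ord _) (hm _).
  have ht (y : ext fm) :
      bag_code (vcount (tag y)) (fY (tag y)) (ext_idx y).+1 <= cbound y.
    exact: (bag_code_bound W1 (fun y => fY (tag y)) (fun y => (ext_idx y).+1)).
  by apply: computable_andb; apply: (computable_compatible W1) => //;
     first [comp_leaf | move=> y; apply: hh].
- exact: computable_tail_codes_in.
- exact: computable_boundary_in_tail.
Qed.

(** The width is a computable function [fm] of the state, so one command serves all widths, in time
    polynomial in the number of cells that the width at hand requires. *)
Lemma computable_cell_step (X : ctx) (fm fa : X -> nat) : sized fm ->
  computable fa -> (forall x, fa x <= cbound x) ->
  computable (fun x => cell_step (vcount x) (fm x) (input_adj (cinp x))
    (cheap x) (fa x)).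
Proof.
move=> W ca ha; have cn := computable_order X; have cm := sized_comp W.
have hm x := ltn_fm_bound W x; have hn x := ltn_order_bound W x.
have cN := computable_bag_bound W; have hN := bag_bound_le W.
have cd j : j <= 4 ->
    computable (fun x => digit (bag_bound (vcount x) (fm x)) (fa x) j).
  move=> hj; apply: computable_digit => //; last by comp_leaf.
    by move=> x; apply: bag_bound_gt0.
  by move=> x; apply: leq_trans (bound_ge16 W x); apply: leq_trans hj _.
have c4 := cd 4 isT; have c3 := cd 3 isT; have c2 := cd 2 isT.
have c1 := cd 1 isT; have c0 := cd 0 isT.
have hd j x : digit (bag_bound (vcount x) (fm x)) (fa x) j <= cbound x.
  by apply: leq_trans (hN x); apply/ltnW/digit_lt/bag_bound_gt0.
rewrite /cell_step /addr_kind /addr_round /addr_idx /addr_val /addr_bag.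
apply: computable_ifb; first by repeat comp_step.
  apply: computable_ifb; first by repeat comp_step.
    rewrite /reach_base; apply: computable_andb; first by repeat comp_step.
    apply: computable_andb; first by repeat comp_step.
    by apply: computable_negb; apply: (computable_in_bag W).
  apply: computable_orb.
    by apply: (computable_heap_reach W) => //; apply: computable_pred.
  apply: computable_andb; first by repeat comp_step.
  apply: computable_andb.
    by apply: computable_negb; apply: (computable_in_bag W).
  apply: computable_has => [//|x|]; first exact/ltnW/hn.
  have W1 := sized_ext (fun x => vcount x) W.
  apply: computable_andb; last by apply: (computable_adj W1); comp_leaf.
  by apply: (computable_heap_reach W1); repeat comp_step.
apply: computable_ifb; first by repeat comp_step.
  apply: computable_andb; first by repeat comp_step.
  apply: computable_all => [|x|]; [by repeat comp_step|exact/ltnW/hm|].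
  pose b (x : X) := (fm x).+1; have W1 := sized_ext b W.
  apply: computable_all => [|y|]; [by repeat comp_step|exact/ltnW/hm|].
  have W2 := sized_ext (fun y : ext b => b (tag y)) W1.
  apply: computable_implyb; apply: computable_eq;
    first [apply: (computable_bag_vertex W2) | apply: (computable_bag_code W2)];
    first [by repeat comp_step | move=> y];
    by first [exact: hd | exact: leq_trans (ltnW (ltn_ord _)) (ltnW (hm _))].
apply: computable_ifb;
  [by apply: (computable_fresh W) => //; apply: computable_pred| |]; last first.
  apply: computable_negb; apply: computable_eq; last by comp_leaf.
  by apply: computable_heap; apply: (computable_addr W); repeat comp_step.
apply: computable_andb; first by repeat comp_step.
apply: computable_has => [|x|]; [by repeat comp_step|exact: hn|].
pose b (x : X) := (vcount x).+1; have W1 := sized_ext b W.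
apply: computable_andb.
  apply: computable_negb; apply: computable_eq; last by comp_leaf.
  by apply: computable_heap; apply: (computable_addr W1); repeat comp_step.
apply: computable_has => [|y|]; [by repeat comp_step|exact: hn|].
have W2 := sized_ext (fun y : ext b => b (tag y)) W1.
apply: computable_has => [|y|]; [by comp_leaf|exact: hN|].
pose b2 (y : ext (fun y : ext b => b (tag y))) :=
  bag_bound (vcount (tag (tag y))) (fm (tag (tag y))).
have W3 := sized_ext b2 W2.
have hZ (y : ext b2) : ext_idx y <= cbound y.
  by apply: leq_trans (ltnW (ltn_ord _)) (hN (tag (tag (tag y)))).
have ch : @computable (ext b2) (fun y => bag_code (vcount y) (ext_idx y) 0).
  by apply: (computable_bag_code W3) => //; comp_leaf.
have hc (y : ext b2) : bag_code (vcount y) (ext_idx y) 0 <= cbound y.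
  exact: (bag_code_bound W3 _ (fun=> 0)).
apply: computable_andb.
  apply: computable_negb; apply: computable_eq; last by comp_leaf.
  by apply: computable_heap; apply: (computable_addr W3); repeat comp_step.
apply: computable_andb.
  apply: computable_eq; last by comp_leaf.
  apply: computable_add; first by repeat comp_step.
  by apply: computable_eq; apply: (computable_code_digit W3).
by apply: (computable_link W3); repeat comp_step.
Qed.

(** * Correctness of the dynamic program *)

Section Components.
Variables (n m : nat) (g : rel nat).
Hypotheses (g_sym : symmetric g) (g_lt : forall u v, g u v -> u < n).
Local Notation V := 'I_n.
Local Notation R := (ranged_reach n m g).

Definition avoiding Z : rel V :=
  [rel x y : V | [&& g x y, ~~ in_bag n m Z x & ~~ in_bag n m Z y]].

Definition conn Z (i u : V) := ~~ in_bag n m Z i && connect (avoiding Z) i u.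

Lemma reach_lt s i u Z : reach n m g s i u Z -> (i < n) && (u < n).
Proof.
elim: s u => [|s IH] u /=; first by case/and3P => /eqP-> ->.
by case/orP=> [/IH//|/and3P[hu _ /hasP[v _ /andP[/IH/andP[-> _] _]]]].
Qed.

Lemma reach_notin s i u Z : reach n m g s i u Z -> ~~ in_bag n m Z u.
Proof.
by elim: s u => [|s IH] u /= => [/and3P[]//|/orP[/IH//|/and3P[]]].
Qed.

Lemma reachP s (i u : V) Z :
  reflect (exists p, [/\ ~~ in_bag n m Z i, path (avoiding Z) i p,
                         last i p = u & size p <= s])
          (reach n m g s i u Z).
Proof.
elim: s u => [|s IH] u; apply: (iffP idP).
- by case/and3P=> /eqP/val_inj<- _ hi; exists [::].
- case=> p [hi _ <-]; rewrite leqn0 => /nilP->.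
  by rewrite /= /reach_base eqxx ltn_ord.
- case/orP=> [/IH[p [h1 h2 h3 h4]]|/and3P[_ hu /hasP[v _ /andP[hv hg]]]].
    by exists p; split=> //; apply: leqW.
  have v_lt : v < n := g_lt hg.
  have /IH[p [h1 h2 h3 h4]] : reach n m g s i (Ordinal v_lt) Z by [].
  exists (rcons p u); split=> //; last by rewrite size_rcons.
    by rewrite rcons_path h2 h3 /avoiding /= hg hu (reach_notin hv).
  by rewrite last_rcons.
- case=> p [hi]; case/lastP: p => [|p v].
    by move=> _ /= <- _; apply/orP; left; apply/IH; exists [::].
  rewrite rcons_path last_rcons size_rcons ltnS => /andP[hp hv] <- hs.
  have hr : reach n m g s i (last i p) Z by apply/IH; exists p.
  case/and3P: hv => hg _ hv; apply/orP; right; apply/and3P; split=> //.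
  apply/hasP; exists (val (last i p)); first by rewrite mem_iota ltn_ord.
  by apply/andP.
Qed.

Lemma reach_conn (i u : V) Z : reach n m g n i u Z = conn Z i u.
Proof.
apply/reachP/andP=> [[p [hi hp <- _]]|[hi /connectP[p hp ->]]].
  by split=> //; apply/connectP; exists p.
case/shortenP: hp => p' hp' up' _; exists p'; split=> //.
have := max_card (mem (i :: p')); rewrite (card_uniqP up') card_ord /=.
exact: ltnW.
Qed.

Lemma ranged_reachE s i u Z : s <= n -> i <= n -> u <= n ->
  Z < bag_bound n m -> R s i u Z = reach n m g s i u Z.
Proof.
have h x : x <= n -> x < bag_bound n m by move/leq_ltn_trans; apply; apply: ltn_n_bag_bound.
by move=> hs hi hu hZ; rewrite /ranged_reach /in_range hZ !h.
Qed.

Lemma ranged_conn (i u : V) Z : Z < bag_bound n m -> R n i u Z = conn Z i u.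
Proof. by move=> hZ; rewrite ranged_reachE ?reach_conn // ltnW. Qed.

Lemma avoiding_sym Z : symmetric (avoiding Z).
Proof. by move=> x y; rewrite /avoiding /= g_sym; congr andb; rewrite andbC. Qed.

Lemma conn_notin Z i u : conn Z i u -> ~~ in_bag n m Z u.
Proof. by rewrite -reach_conn; apply: reach_notin. Qed.

Lemma conn_refl Z u : conn Z u u = ~~ in_bag n m Z u.
Proof. by rewrite /conn connect0 andbT. Qed.

Lemma conn_sym Z : symmetric (conn Z).
Proof.
have h i u : conn Z i u -> conn Z u i.
  move=> hc; have hu := conn_notin hc; case/andP: hc => hi hc.
  by rewrite /conn hu (sym_connect_sym (@avoiding_sym Z)).
by move=> i u; apply/idP/idP; apply: h.
Qed.

Lemma conn_trans Z : transitive (conn Z).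
Proof.
by move=> u i v /andP[hi h1] /andP[_ h2]; rewrite /conn hi (connect_trans h1).
Qed.

Lemma conn_edge Z i (u z : V) : conn Z i u -> g u z -> ~~ in_bag n m Z z ->
  conn Z i z.
Proof.
move=> hc hg hz; have hu := conn_notin hc; apply: conn_trans hc _.
by rewrite /conn hu; apply: connect1; rewrite /avoiding /= hg hu hz.
Qed.

Definition component Z i := [set u | conn Z i u].

Definition touching Z (u : V) :=
  [exists y, conn Z u y && ((bag_vertex n Z 0 == n) || g y (bag_vertex n Z 0))].

(** The set that an entry of [table] with index i speaks about; for i = n it consists of all
    components touching the head. *)
Definition processed Z i :=
  [set u | touching Z u && [exists i' : V, (i' < i) && conn Z i' u]].

Lemma touchesE Z (u : V) : Z < bag_bound n m -> touches n g R Z u = touching Z u.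
Proof.
move=> hZ; apply/hasP/existsP => [[y]|[y hy]].
  rewrite mem_iota => /= hy; rewrite -[y]/(val (Ordinal hy)) ranged_conn //.
  by exists (Ordinal hy).
by exists (val y); rewrite ?mem_iota ?ltn_ord //= ranged_conn.
Qed.

Lemma freshE Z (i : V) : Z < bag_bound n m -> fresh n g R Z i =
  touching Z i && ~~ [exists i' : V, (i' < i) && conn Z i' i].
Proof.
move=> hZ; rewrite /fresh touchesE //; congr (_ && ~~ _).
apply/hasP/existsP => [[y]|[y hy]].
  rewrite mem_iota => /= hy; rewrite -[y]/(val (Ordinal hy)) ranged_conn //.
  by exists (Ordinal hy).
by exists (val y); rewrite ?mem_iota ?ltn_ord //= ranged_conn.
Qed.

Lemma fresh_lt Z i : fresh n g R Z i -> i < n.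
Proof.
case/andP=> /hasP[u _ /andP[]]; rewrite /ranged_reach => /andP[_ /reach_lt].
by case/andP.
Qed.

Lemma touching_conn Z i u : conn Z i u -> touching Z u -> touching Z i.
Proof.
move=> hc /existsP[y /andP[hy ht]]; apply/existsP; exists y.
by rewrite (conn_trans hc hy).
Qed.

Lemma processed0 Z : processed Z 0 = set0.
Proof.
by apply/setP => u; rewrite !inE; apply/negbTE/negP => /andP[_ /existsP[]].
Qed.

Lemma processed_stale Z i : Z < bag_bound n m -> ~~ fresh n g R Z i ->
  processed Z i.+1 = processed Z i.
Proof.
move=> hZ hf; apply/setP => u; rewrite !inE; apply/andP/andP => -[ht /existsP[k]].
  move=> /andP[hk hc]; split=> //; move: hk; rewrite ltnS leq_eqVlt.
  case/orP=> [/eqP ek|hk]; last by apply/existsP; exists k; rewrite hk.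
  move: hf; rewrite -ek freshE // (touching_conn hc ht) /= negbK.
  case/existsP=> k' /andP[hk' hc']; apply/existsP; exists k'.
  by rewrite hk' (conn_trans hc' hc).
move=> /andP[hk hc]; split=> //; apply/existsP; exists k.
by rewrite hc ltnW.
Qed.

Lemma processed_fresh Z (i : V) : Z < bag_bound n m -> fresh n g R Z i ->
  processed Z i.+1 = processed Z i :|: component Z i.
Proof.
move=> hZ; rewrite freshE // => /andP[ht _]; apply/setP => u; rewrite !inE.
apply/andP/orP => [[hu /existsP[k /andP[hk hc]]]|[/andP[hu /existsP[k /andP[hk hc]]]|hc]].
- move: hk; rewrite ltnS leq_eqVlt => /orP[/eqP/val_inj ek|hk].
    by right; rewrite -ek.
  by left; rewrite hu; apply/existsP; exists k; rewrite hk.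
- by split=> //; apply/existsP; exists k; rewrite hc ltnW.
- split; first by move: ht; apply: touching_conn; rewrite conn_sym.
  by apply/existsP; exists i; rewrite ltnSn.
Qed.

Lemma processed_comp_disjoint Z (i : V) : Z < bag_bound n m ->
  fresh n g R Z i -> [disjoint processed Z i & component Z i].
Proof.
move=> hZ; rewrite freshE // => /andP[_ hn].
rewrite disjoint_subset; apply/subsetP => u; rewrite !inE.
case/andP=> _ /existsP[k /andP[hk hc]]; apply: contra hn => hi.
by apply/existsP; exists k; rewrite hk (conn_trans hc) // conn_sym.
Qed.

Lemma processed_notin Z i u : u \in processed Z i -> ~~ in_bag n m Z u.
Proof. by rewrite inE => /andP[_ /existsP[k /andP[_ /conn_notin]]]. Qed.

Lemma processed_edge Z i (u z : V) : u \in processed Z i -> g u z ->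
  (z \in processed Z i) || in_bag n m Z z.
Proof.
rewrite !inE => /andP[ht /existsP[k /andP[hk hc]]] hg.
case hz : (in_bag n m Z z); rewrite ?orbT // orbF.
have hkz : conn Z k z by apply: conn_edge hg _; rewrite ?hz.
rewrite (touching_conn _ ht); first by apply/existsP; exists k; rewrite hk.
by apply: conn_trans hc; rewrite conn_sym.
Qed.

(* Z' takes over the component of i: its head u lies in the component, and the
   tail separates the component from the rest of the graph. *)
Record split_at Z (i : V) Z' (u : V) : Prop := SplitAt {
  split_head : bag_vertex n Z' 0 = u;
  split_conn : conn Z i u;
  split_tail : forall j, j < m ->
    exists2 j', j' <= m & bag_vertex n Z' j.+1 = bag_vertex n Z j';
  split_boundary : forall x z : V, conn Z i x -> g x z -> ~~ conn Z i z ->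
    in_tail n m Z' z }.

Lemma in_bagE Z u : in_bag n m Z u = (bag_vertex n Z 0 == u) || in_tail n m Z u.
Proof.
by rewrite /in_bag /in_tail /= (iotaDl 1 0) has_map.
Qed.

Lemma split_in_bag Z i Z' u z : split_at Z i Z' u -> in_bag n m Z' z ->
  z = u \/ in_bag n m Z z.
Proof.
move=> [h1 _ h3 _]; rewrite in_bagE h1 => /orP[/eqP->|]; first by left.
case/hasP=> j; rewrite mem_iota => hj /eqP<-; right.
have [j' hj' ->] := h3 _ hj; apply/hasP; exists j' => //.
by rewrite mem_iota.
Qed.

(** Since the component is connected, a path inside it from any other vertex to u shows that this
    vertex lies in a remaining component touching u. Conversely, a remaining component touching u
    cannot leave the old one, as the tail of Z' contains the whole boundary. *)
Lemma comp_split Z (i : V) Z' (u : V) : split_at Z i Z' u ->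
  component Z i = u |: processed Z' n.
Proof.
move=> S; have [h1 h2 h3 h4] := S.
have un : (bag_vertex n Z' 0 == n) = false by rewrite h1 ltn_eqF // ltn_ord.
have stay x y : conn Z i x -> conn Z' x y -> conn Z i y.
  move=> hx /andP[_ /connectP[p hp ->]]; elim: p x hx hp => //= y' p IH x hx.
  case/andP=> /and3P[hg _ hy']; apply: IH; apply: contraNT hy' => hn.
  by rewrite in_bagE (h4 _ _ hx hg hn) orbT.
apply/setP => x; rewrite !inE; apply/idP/orP => [hx|[/eqP->//|]].
  case: eqVneq => [|xu]; [by left|right].
  have hxZ : ~~ in_bag n m Z' x.
    apply/negP => /(split_in_bag S)[/val_inj/eqP|]; first exact/negP.
    exact/negP/(conn_notin hx).
  apply/andP; split; last first.
    by apply/existsP; exists x; rewrite ltn_ord conn_refl.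
  have : conn Z x u by apply: conn_trans h2; rewrite conn_sym.
  case/andP=> _ /connectP[p hp hl]; elim: p x hx xu hxZ hp hl => [|y p IH] x hx xu hxZ.
    by move=> _ /= e; rewrite e eqxx in xu.
  case/andP=> /and3P[hg hxn hyn] hp hl; case: (eqVneq y u) => [e|yu].
    by apply/existsP; exists x; rewrite conn_refl hxZ un h1 -e.
  have hy := conn_edge hx hg hyn.
  have hyZ : ~~ in_bag n m Z' y.
    apply/negP => /(split_in_bag S)[/val_inj/eqP|]; first exact/negP.
    exact/negP.
  apply: touching_conn (IH y hy yu hyZ hp hl).
  by apply: (@conn_edge _ _ x) => //; rewrite conn_refl.
case/andP=> /existsP[y]; rewrite un h1 /= => /andP[hxy hg] _.
have hy : conn Z i y.
  apply/negPn/negP => hn; have := conn_notin hxy; rewrite in_bagE.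
  by rewrite (h4 u) ?orbT // g_sym.
by apply: stay hy _; rewrite conn_sym.
Qed.

Lemma split_head_notin Z i Z' u k : split_at Z i Z' u -> u \notin processed Z' k.
Proof.
move=> [h1 _ _ _]; apply/negP => /processed_notin.
by rewrite in_bagE h1 eqxx.
Qed.

End Components.

(** * From the table to a labelling *)

Section Table.
Variables (n m : nat) (g : rel nat).
Hypotheses (g_sym : symmetric g) (g_lt : forall u v, g u v -> u < n).
Hypothesis g_irr : irreflexive g.
Local Notation V := 'I_n.
Local Notation R := (ranged_reach n m g).
Local Notation N := (bag_bound n m).
Local Notation conn := (conn m g).
Local Notation component := (component m g).
Local Notation processed := (processed n m g).
Local Notation touching := (touching m g).

Definition starts (lam : nat -> nat) (S : {set V}) : nat :=
  \sum_(v in S) is_start n (lam v).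

(** Edges that leave S are included. This is why soundness also has to prescribe the labels on the
    bag, where those edges end. *)
Definition valid_on (lam : nat -> nat) (S : {set V}) : Prop :=
  forall u, u \in S ->
  [/\ code_vertex n (lam u) = u, admissible n m g R (lam u) &
      forall u' : V, g u u' ->
        compatible n (lam u) (lam u') && compatible n (lam u') (lam u)].

Lemma startsU lam (A B : {set V}) : [disjoint A & B] ->
  starts lam (A :|: B) = starts lam A + starts lam B.
Proof.
move=> dAB; rewrite /starts -bigU //; apply: eq_bigl => x; exact: in_setU.
Qed.

Lemma startsU1 lam (u : V) (A : {set V}) : u \notin A ->
  starts lam (u |: A) = is_start n (lam u) + starts lam A.
Proof. by move=> uA; rewrite /starts big_setU1. Qed.

Lemma starts_le lam S : starts lam S <= n.
Proof.
apply: leq_trans (_ : \sum_(v in S) 1 <= _).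
  by apply: leq_sum => v _; case: is_start.
by rewrite sum1_card -[X in _ <= X]card_ord max_card.
Qed.

Lemma bag_vertex_le Z j : bag_vertex n Z j <= n.
Proof. by rewrite -ltnS; apply: digit_lt. Qed.

Lemma mem_bag Z j : j <= m -> in_bag n m Z (bag_vertex n Z j).
Proof. by move=> hj; apply/hasP; exists j; rewrite ?mem_iota. Qed.

Lemma link_split Z (i : V) Z' : Z < N -> link n m g R Z i Z' ->
  exists u : V, split_at m g Z i Z' u.
Proof.
move=> hZ /and5P[h1 _ _ h4 h5].
have hu : bag_vertex n Z' 0 < n.
  by move: h1; rewrite /ranged_reach => /andP[_ /reach_lt/andP[]].
exists (Ordinal hu); split=> // [|j hj|x z hx hg hz].
- by rewrite -ranged_conn.
- have /allP/(_ j) := h4; rewrite mem_iota => /(_ hj)/hasP[j'].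
  by rewrite mem_iota => hj' /eqP e; exists j'; rewrite // /bag_vertex e.
- have /allP/(_ x) := h5; rewrite mem_iota ltn_ord => /(_ isT).
  rewrite ranged_conn // hx => /allP/(_ z); rewrite mem_iota ltn_ord => /(_ isT).
  by rewrite hg ranged_conn // (negbTE hz).
Qed.

Lemma consistent_labels Z : consistent n m Z ->
  exists lam, forall j, j <= m -> lam (bag_vertex n Z j) = bag_code n Z j.
Proof.
move=> hc; pose idx v := find (fun j => bag_vertex n Z j == v) (iota 0 m.+1).
exists (fun v => bag_code n Z (idx v)) => j hj.
have hP : has (fun k => bag_vertex n Z k == bag_vertex n Z j) (iota 0 m.+1).
  exact: mem_bag.
have hf : idx (bag_vertex n Z j) < m.+1 by rewrite has_find size_iota in hP.
have := nth_find 0 hP; rewrite nth_iota // add0n => hv.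
have /allP/(_ (idx (bag_vertex n Z j))) := hc; rewrite mem_iota => /(_ hf).
by move=> /allP/(_ j); rewrite mem_iota => /(_ hj)/implyP/(_ hv)/eqP.
Qed.

(** The new labelling [lamb] follows the child's [lam'] on the component of i and [lam] elsewhere.
    Both agree on the tail of Z', since its codes are copied from Z, and no other vertex outside the
    component has a neighbour in it. So every vertex keeps the labels of its neighbours. *)
Lemma table_sound s i Z c : Z < N -> table n m g R s i Z c ->
  exists lam, [/\ forall j, j <= m -> bag_vertex n Z j < n ->
                    lam (bag_vertex n Z j) = bag_code n Z j,
                  valid_on lam (processed Z i) & starts lam (processed Z i) = c].
Proof.
have base s' Y c' : table n m g R s' 0 Y c' -> exists lam,
    [/\ forall j, j <= m -> bag_vertex n Y j < n ->
          lam (bag_vertex n Y j) = bag_code n Y j,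
        valid_on lam (processed Y 0) & starts lam (processed Y 0) = c'].
  rewrite table0 => /andP[/eqP-> /consistent_labels[lam hlam]]; exists lam.
  by rewrite processed0 /starts big_set0; split=> // [j hj _|u]; rewrite ?inE ?hlam.
elim: s i Z c => [|s IHs] i Z c hZ; elim: i c => [|i IHi] c; try exact: base.
- rewrite tableS /table_step; case hf : fresh => // /IHi[lam [h1 h2 h3]].
  by exists lam; rewrite processed_stale ?hf.
rewrite tableS /table_step; case hf : fresh; last first.
  by move=> /IHi[lam [h1 h2 h3]]; exists lam; rewrite processed_stale ?hf.
case/andP=> _ /hasP[c1 _ /andP[/IHi[lam [h1 h2 h3]]]].
case/hasP=> c2 _ /hasP[Z']; rewrite mem_iota => hZ' /and3P[].
move/(IHs _ _ _ hZ') => [lam' [k1 k2 k3]] /eqP ec hl.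
have hi := fresh_lt hf; set io : V := Ordinal hi.
have [u S] := link_split (i := io) hZ hl; have [s1 s2 s3 s4] := S.
have hC := comp_split g_sym g_lt S; have un := split_head_notin g_lt n S.
pose lamb v := if reach n m g n io v Z then lam' v else lam v.
have lambE (x : V) : lamb x = if x \in component Z io then lam' x else lam x.
  by rewrite /lamb reach_conn // inE.
have k0 : lam' u = bag_code n Z' 0 by rewrite -{1}s1 k1 // s1.
have lamb_tail (x : V) : in_tail n m Z' x -> lamb x = lam' x.
  move=> hx; have [j hj ej] : exists2 j, j < m & bag_vertex n Z' j.+1 = x.
    by case/hasP: hx => j; rewrite mem_iota => hj /eqP; exists j.
  have /and5P[_ _ _ /allP/(_ j)+ _] := hl.
  rewrite mem_iota => /(_ hj)/hasP[j']; rewrite mem_iota => hj' /eqP e.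
  have ex : bag_vertex n Z j' = x by rewrite /bag_vertex -e.
  have -> : lamb x = lam x.
    rewrite lambE inE ifN //; apply/negP => /(conn_notin g_lt).
    by rewrite -ex mem_bag.
  by rewrite -{1}ex h1 ?ex // -e -ej k1 // ?ej //.
have lamb_nbr (x y : V) : x \in component Z io -> g x y -> lamb y = lam' y.
  rewrite inE => hx hg; case hy : (y \in component Z io); first by rewrite lambE hy.
  by apply/lamb_tail/(s4 x) => //; rewrite inE in hy; rewrite hy.
have dis := processed_comp_disjoint g_sym g_lt hZ (hf : fresh n g R Z io).
have lamb_old (x : V) : (x \in processed Z io) || in_bag n m Z x -> lamb x = lam x.
  move=> hx; rewrite lambE ifN //; case/orP: hx => hx.
    by rewrite (disjointFr dis).
  by rewrite inE; apply/negP => /(conn_notin g_lt); rewrite hx.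
exists lamb; rewrite -[i]/(val io) (processed_fresh g_sym g_lt hZ (hf : fresh n g R Z io)); split.
- move=> j hj hv; rewrite -(h1 _ hj hv) -[bag_vertex n Z j]/(val (Ordinal hv)).
  by apply: lamb_old; rewrite mem_bag ?orbT.
- move=> x; rewrite inE => /orP[hx|hx].
    have [e1 e2 e3] := h2 x hx; rewrite lamb_old ?hx //; split=> // y hg.
    by rewrite (lamb_old y) ?e3 // (processed_edge g_sym g_lt hx).
  have ex : lamb x = lam' x by rewrite lambE hx.
  have /and5P[_ l2 l3 _ _] := hl.
  case: (eqVneq x u) => [exu|xu].
    rewrite ex exu k0; split=> // y hg; rewrite (lamb_nbr x) ?exu //; last first.
      by rewrite inE.
    (* An edge from the head into the rest of the component was checked at its other end, one that
       leaves the component is checked by [link]. *)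
    case hy : (y \in component Z io).
      move: hy; rewrite hC in_setU1 => /orP[/eqP ey|hy].
        by rewrite ey g_irr in hg.
      have [_ _ /(_ u)] := k2 y hy; rewrite g_sym hg -k0 andbC; exact.
    have : in_tail n m Z' y by apply: (s4 u) => //; rewrite inE in hy; rewrite hy.
    case/hasP=> j; rewrite mem_iota => hj /eqP ey; rewrite -ey k1 ?ey //.
    by have /allP/(_ j) := l3; rewrite mem_iota; apply.
  have hx' : x \in processed Z' n.
    by move: hx; rewrite hC in_setU1 (negbTE xu).
  have [e1 e2 e3] := k2 x hx'; rewrite ex; split=> // y hg.
  by rewrite (lamb_nbr x) ?e3.
rewrite startsU // -ec -h3 -k3.
rewrite -addnA; congr (_ + _).
  by apply: eq_bigr => x hx; rewrite lamb_old // hx.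
transitivity (starts lam' (component Z io)).
  by apply: eq_bigr => x hx; rewrite lambE hx.
by rewrite hC startsU1 // k0 addnC.
Qed.

Lemma digits_exist b k (f : nat -> nat) : (forall j, j < k -> f j < b) ->
  exists2 Z, Z < b ^ k & forall j, j < k -> digit b Z j = f j.
Proof.
elim: k f => [|k IH] f hf; first by exists 0.
have [|Z hZ eZ] := IH (fun j => f j.+1); first by move=> j hj; apply: hf.
have f0 := hf 0 isT; exists (b * Z + f 0).
  exact: ltn_mulD_exp.
by case=> [|j] hj; rewrite ?digitM ?digitMS // eZ.
Qed.

Lemma digit_max b k j : 0 < b -> j < k -> digit b (b ^ k).-1 j = b.-1.
Proof.
case: b => // b _; elim: k j => // k IH j hj.
have -> : (b.+1 ^ k.+1).-1 = b.+1 * (b.+1 ^ k).-1 + b.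
  by rewrite expnS; case: (b.+1 ^ k) (expn_gt0 b.+1 k) => // x _; rewrite mulnS; lia.
by case: j hj => [|j] hj; rewrite ?digitM ?digitMS // IH.
Qed.

Lemma empty_bag_lt : empty_bag n m < N.
Proof. by rewrite /empty_bag prednK // bag_bound_gt0. Qed.

Lemma empty_bag_code j : j <= m -> bag_code n (empty_bag n m) j = (code_base n).-1.
Proof. by move=> hj; rewrite /bag_code digit_max // code_base_gt0. Qed.

Lemma empty_bag_vertex j : j <= m -> bag_vertex n (empty_bag n m) j = n.
Proof. by move=> hj; rewrite /bag_vertex empty_bag_code // /code_vertex digit_max. Qed.

Lemma in_empty_bag (u : V) : ~~ in_bag n m (empty_bag n m) u.
Proof.
apply/hasP=> -[j]; rewrite mem_iota => hj; rewrite empty_bag_vertex //.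
by rewrite gtn_eqF.
Qed.

Lemma processed_empty_bag : processed (empty_bag n m) n = setT.
Proof.
apply/setP => u; rewrite !inE; apply/andP; split; apply/existsP; exists u.
  by rewrite conn_refl in_empty_bag empty_bag_vertex // eqxx.
by rewrite conn_refl in_empty_bag ltn_ord.
Qed.

(* A solution of the labelling problem, extended by the code of the empty bag
   at the missing vertex n. *)
Record labelling (lam : nat -> nat) : Prop := Labelling {
  lab_lt : forall v, v <= n -> lam v < code_base n;
  lab_none : lam n = (code_base n).-1;
  lab_valid : valid_on lam setT }.

(** * From a labelling to the table *)

Section Labelled.
Variable lam : nat -> nat.
Hypothesis Hlam : labelling lam.

Lemma lab_vertex v : v <= n -> code_vertex n (lam v) = v.
Proof.
rewrite leq_eqVlt => /orP[/eqP->|hv]; first by rewrite (lab_none Hlam) /code_vertex digit_max.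
by have [] := lab_valid Hlam (in_setT (Ordinal hv)).
Qed.

Lemma lab_pred v : v <= n ->
  code_pred n (lam v) = v \/ g (code_pred n (lam v)) v.
Proof.
rewrite leq_eqVlt => /orP[/eqP->|hv].
  by left; rewrite (lab_none Hlam) /code_pred digit_max.
have [/= e + _] := lab_valid Hlam (in_setT (Ordinal hv)).
rewrite /admissible /is_start e.
by case/andP=> /orP[/andP[/eqP h _]|/andP[h _]] _; [left|right].
Qed.

Lemma lab_succ v : v <= n ->
  code_succ n (lam v) = v \/ g (code_succ n (lam v)) v.
Proof.
rewrite leq_eqVlt => /orP[/eqP->|hv].
  by left; rewrite (lab_none Hlam) /code_succ digit_max.
have [/= e + _] := lab_valid Hlam (in_setT (Ordinal hv)).
by rewrite /admissible e => /andP[_ /orP[/eqP->|]]; [left|rewrite g_sym; right].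
Qed.

(** For vertices that are not adjacent both implications are vacuous, because p and s are v itself
    or neighbours of v. So [link] may test all tail positions without consulting the edges. *)
Lemma lab_compatible u z : u <= n -> z <= n -> compatible n (lam u) (lam z).
Proof.
move=> hu hz; case guz : (g u z).
  have gzu : g z u by rewrite g_sym.
  have [_ _ /(_ (Ordinal (g_lt gzu)))] :=
    lab_valid Hlam (in_setT (Ordinal (g_lt guz))).
  by move=> /(_ guz)/andP[].
rewrite /compatible !lab_vertex //; apply/andP; split; apply/implyP.
  case/andP=> /eqP e zu; have [h|h] := lab_pred hu.
    by rewrite -e h eqxx in zu.
  by rewrite e g_sym guz in h.
case/andP=> /eqP e zu; have [h|h] := lab_succ hu.
  by rewrite -e h eqxx in zu.
by rewrite e g_sym guz in h.
Qed.

Definition labelled Z := forall j, j <= m -> bag_code n Z j = lam (bag_vertex n Z j).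

Lemma labelled_bag (f : nat -> nat) : (forall j, j <= m -> f j <= n) ->
  exists Z, [/\ Z < N, labelled Z & forall j, j <= m -> bag_vertex n Z j = f j].
Proof.
move=> hf; have hlt j : j < m.+1 -> lam (f j) < code_base n.
  by move=> hj; apply/(lab_lt Hlam)/hf.
have [Z hZ eZ] := digits_exist hlt.
have ev j : j <= m -> bag_vertex n Z j = f j.
  by move=> hj; rewrite /bag_vertex /bag_code eZ // lab_vertex // hf.
by exists Z; split=> // j hj; rewrite ev // /bag_code eZ.
Qed.

Lemma labelled_empty_bag : labelled (empty_bag n m).
Proof. by move=> j hj; rewrite empty_bag_code // empty_bag_vertex // (lab_none Hlam). Qed.

Lemma labelled_consistent Z : labelled Z -> consistent n m Z.
Proof.
move=> hl; apply/allP => j; rewrite mem_iota => hj; apply/allP => j'.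
rewrite mem_iota => hj'; apply/implyP => /eqP e.
by rewrite (hl j) // (hl j') // e.
Qed.

(** All conditions on labels hold when the codes come from one solution; what remains is [split_at],
    which speaks about vertices only. *)
Lemma labelled_link Z (i : V) Z' u : Z < N -> labelled Z -> labelled Z' ->
  split_at m g Z i Z' u -> link n m g R Z i Z'.
Proof.
move=> hZ hl hl' [s1 s2 s3 s4]; apply/and5P; split.
- by rewrite s1 ranged_conn.
- by rewrite hl' // s1; have [] := lab_valid Hlam (in_setT u).
- apply/allP => j; rewrite mem_iota => hj; rewrite !hl' //.
  by rewrite !lab_compatible ?bag_vertex_le.
- apply/allP => j; rewrite mem_iota => hj; have [j' hj' e] := s3 j hj.
  by apply/hasP; exists j'; rewrite ?mem_iota // hl' // hl // e.
- apply/allP => x; rewrite mem_iota => /= hx; apply/implyP.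
  rewrite -[x]/(val (Ordinal hx)) ranged_conn // => hc.
  apply/allP => z; rewrite mem_iota => /= hz; apply/implyP => hg.
  rewrite -[z]/(val (Ordinal hz)) ranged_conn //.
  by case hcz : (conn _ _ _) => //=; apply: (s4 (Ordinal hx) (Ordinal hz)) => //; rewrite hcz.
Qed.

Lemma table_extend s Z (i : V) Z' u : Z < N -> Z' < N ->
  labelled Z -> labelled Z' -> split_at m g Z i Z' u -> fresh n g R Z i ->
  table n m g R s.+1 i Z (starts lam (processed Z i)) ->
  table n m g R s n Z' (starts lam (processed Z' n)) ->
  table n m g R s.+1 i.+1 Z (starts lam (processed Z i.+1)).
Proof.
move=> hZ hZ' hl hl' S hf h1 h2; rewrite tableS /table_step hf.
apply/andP; split=> //; apply/hasP.
exists (starts lam (processed Z i)); first by rewrite mem_iota ltnS starts_le.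
apply/andP; split=> //; apply/hasP.
exists (starts lam (processed Z' n)); first by rewrite mem_iota ltnS starts_le.
apply/hasP; exists Z'; first by rewrite mem_iota.
apply/and3P; split=> //; last exact: labelled_link S.
rewrite (processed_fresh g_sym g_lt hZ hf) startsU; last first.
  exact: processed_comp_disjoint.
rewrite (comp_split g_sym g_lt S) startsU1; last exact: (split_head_notin g_lt n S).
by rewrite hl' // (split_head S) -addnA [X in _ == _ + X]addnC.
Qed.

Lemma table_start s Z : labelled Z -> table n m g R s 0 Z (starts lam (processed Z 0)).
Proof.
move=> hl; rewrite table0 processed0 /starts big_set0.
exact: labelled_consistent.
Qed.

Section SameBag.
Variables Y Z : nat.
Hypothesis hYZ : forall j, j <= m -> bag_vertex n Y j = bag_vertex n Z j.

Lemma same_in_bag u : in_bag n m Y u = in_bag n m Z u.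
Proof. by apply: eq_in_has => j; rewrite mem_iota => hj; rewrite hYZ. Qed.

Lemma same_in_tail u : in_tail n m Y u = in_tail n m Z u.
Proof. by apply: eq_in_has => j; rewrite mem_iota => hj; rewrite hYZ. Qed.

Lemma same_conn (i u : V) : conn Y i u = conn Z i u.
Proof.
apply: (congr2 andb); first by rewrite same_in_bag.
apply: eq_connect => x y.
by rewrite /avoiding /= !same_in_bag.
Qed.

Lemma same_touching (u : V) : touching Y u = touching Z u.
Proof. by apply: eq_existsb => y; rewrite same_conn hYZ. Qed.

Lemma same_fresh i : Y < N -> Z < N -> fresh n g R Y i = fresh n g R Z i.
Proof.
move=> hY hZ; case: (ltnP i n) => hi.
  rewrite -[i]/(val (Ordinal hi)) !freshE // same_touching.
  by congr (_ && ~~ _); apply: eq_existsb => y; rewrite same_conn.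
have h Y' : fresh n g R Y' i = false.
  by apply/negbTE/negP => /fresh_lt; rewrite ltnNge hi.
by rewrite !h.
Qed.
End SameBag.

(* Only the vertices of the bags of a derivation matter: relabelling all of
   them by lam turns it into a derivation for lam. *)
Lemma table_transfer s i Z c Y : Z < N -> table n m g R s i Z c -> Y < N ->
  labelled Y -> (forall j, j <= m -> bag_vertex n Y j = bag_vertex n Z j) ->
  table n m g R s i Y (starts lam (processed Y i)).
Proof.
elim: s i Z c Y => [|s IHs] i Z c Y hZ + hY lY hYZ;
  elim: i c => [|i IHi] c; rewrite ?tableS; try by move=> _; exact: table_start.
  rewrite /table_step (same_fresh hYZ) //; case hf : fresh => //.
  by move/IHi; rewrite processed_stale // (same_fresh hYZ) // hf.
rewrite {1}/table_step; case hf : fresh; last first.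
  move/IHi => h; rewrite /table_step (same_fresh hYZ) // hf.
  by rewrite processed_stale // (same_fresh hYZ) // hf.
case/andP=> _ /hasP[c1 _ /andP[/IHi hi]].
case/hasP=> c2 _ /hasP[Z']; rewrite mem_iota => hZ' /and3P[ht _ hl].
set io : V := Ordinal (fresh_lt hf).
have [u [s1 s2 s3 s4]] := link_split (i := io) hZ hl.
(* Y' has the vertices of the guessed bag Z' and the codes of [lam]. *)
have [Y' [hY' lY' hYZ']] := labelled_bag (fun j _ => bag_vertex_le Z' j).
have hlast := IHs _ _ _ _ hZ' ht hY' lY' hYZ'.
rewrite -tableS; apply: (@table_extend s Y io Y' u) => //; last first.
  by rewrite (same_fresh hYZ).
split=> [||j hj|x z].
- by rewrite hYZ'.
- by rewrite (same_conn hYZ).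
- by have [j' hj' e] := s3 j hj; exists j' => //; rewrite hYZ' // hYZ.
- by rewrite !(same_conn hYZ) (same_in_tail hYZ'); exact: s4.
Qed.

Definition boundary (D : {set V}) := [set z | (z \notin D) && [exists d in D, g d z]].

Definition inside (D : {set V}) : rel V := [rel a b : V | [&& a \in D, b \in D & g a b]].

Definition dominated (key : V -> nat) (D : {set V}) :=
  forall x z x' : V, x \in D -> g x z -> z \notin D -> x' \in D -> key x' <= key z.

(** All that completeness has to know about treewidth. Keys occur in proofs only; the program never
    computes them. *)
Definition elimination_key (key : V -> nat) :=
  forall D : {set V}, D != set0 -> {in D &, forall x y, connect (inside D) x y} ->
  dominated key D -> #|boundary D| <= m.

Lemma component_connected Z i :
  {in component Z i &, forall x y, connect (inside (component Z i)) x y}.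
Proof.
move=> x y; rewrite !inE => hx hy; have hxy : conn Z x y.
  by apply: conn_trans hy; rewrite conn_sym.
case/andP: hxy => _ /connectP[p hp ->]; elim: p x hx hp => [|z p IH] x hx //=.
case/andP=> /and3P[hg h1 h2] hp; have hz := conn_edge g_lt hx hg h2.
by apply: connect_trans (IH z hz hp); apply: connect1; rewrite /inside /= !inE hx hz.
Qed.

(** Each bag takes its head out of the component, so s nested bags suffice for components of at most
    s vertices. The boundary of the component fits into the tail by [elimination_key]. *)
Lemma table_complete key s Z : 0 < m -> elimination_key key -> Z < N -> labelled Z ->
  (forall x, touching Z x ->
     #|component Z x| <= s /\ dominated key (component Z x)) ->
  forall i, i <= n -> table n m g R s i Z (starts lam (processed Z i)).
Proof.
move=> m0 hkey; elim: s Z => [|s IHs] Z hZ lZ hc; elim=> [|i IHi] hi;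
  try exact: table_start; have {}IHi := IHi (ltnW hi); case hf : (fresh n g R Z i).
2,4: by rewrite tableS /table_step hf processed_stale ?hf.
  have := hf; rewrite -[i]/(val (Ordinal hi)) freshE // => /andP[ht _].
  have [] := hc _ ht; rewrite leqn0 cards_eq0 => /eqP/setP/(_ (Ordinal hi)).
  rewrite !inE conn_refl => /negbT/negPn hin _.
  by case/existsP: ht => y /andP[/andP[]]; rewrite hin.
pose io : V := Ordinal hi; set C := component Z io.
have ht : touching Z io by move: hf; rewrite -[i]/(val io) freshE // => /andP[].
have ioC : io \in C by rewrite inE conn_refl; case/existsP: ht => y /andP[/andP[]].
have [szC domC] := hc _ ht; rewrite -/C in szC domC.
have bdC : #|boundary C| <= m.
  apply: hkey domC; first by apply/set0Pn; exists io.
  exact: component_connected.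
have [u uC umax] : exists2 u, u \in C & forall x, x \in C -> key x <= key u.
  by case: (arg_maxnP key ioC) => u; exists u.
(* The head is u and the tail lists the boundary of C; surplus positions repeat the head of Z, so
   that every tail vertex stems from Z. *)
pose f j := if j is j'.+1 then nth (bag_vertex n Z 0) (map val (enum (boundary C))) j'
            else val u.
have bdZ (z : V) : z \in boundary C -> in_bag n m Z z.
  rewrite inE => /andP[zC /existsP[d /andP[dC hg]]]; apply: contraNT zC => hz.
  by move: dC; rewrite !inE => dC; apply: conn_edge hg hz.
have fZ j : in_bag n m Z (f j.+1).
  rewrite /f; case: (ltnP j #|boundary C|) => hj; last first.
    by rewrite nth_default ?size_map -?cardE // mem_bag.
  rewrite (nth_map u) -?cardE //; apply: bdZ.
  by rewrite -mem_enum mem_nth // -cardE.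
have bag_le z : in_bag n m Z z -> exists2 j', j' <= m & bag_vertex n Z j' = z.
  by case/hasP=> j; rewrite mem_iota => hj /eqP; exists j.
have [|Z' [hZ' lZ' fE]] := @labelled_bag f.
  case=> [|j] _; first by rewrite /= ltnW.
  by have [j' hj' <-] := bag_le _ (fZ j); apply: bag_vertex_le.
have S : split_at m g Z io Z' u.
  split=> [||j hj|x z hx hg hz]; first by rewrite fE.
  + by rewrite inE in uC.
  + by rewrite fE //; have [j' hj' <-] := bag_le _ (fZ j); exists j'.
  have zb : z \in boundary C.
    by rewrite !inE hz; apply/existsP; exists x; rewrite inE hx.
  have zi : index z (enum (boundary C)) < #|boundary C|.
    by rewrite cardE index_mem mem_enum.
  apply/hasP; exists (index z (enum (boundary C))).
    by rewrite mem_iota; apply: leq_trans zi bdC.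
  rewrite fE /f; last exact: leq_trans zi bdC.
  by rewrite (nth_map u) -?cardE // nth_index // mem_enum.
have CE := comp_split g_sym g_lt S; have un := split_head_notin g_lt n S.
apply: (@table_extend s Z io Z' u) => //; apply: IHs => // x tx.
have sub : component Z' x \subset processed Z' n.
  apply/subsetP => y; rewrite !inE => hy.
  rewrite (touching_conn _ tx) 1?conn_sym //.
  by apply/existsP; exists x; rewrite ltn_ord.
have subC : component Z' x \subset C.
  by rewrite /C CE; apply: subset_trans sub (subsetUr _ _).
split.
  apply: leq_trans (subset_leq_card sub) _.
  by move: szC; rewrite /C CE cardsU1 un.
move=> y z y' hy hg hz hy'.
have hyC := subsetP subC _ hy; have hyC' := subsetP subC _ hy'.
(* A neighbour z of the smaller component either lies outside C, where C was already dominated, or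
   is the new head u, the heaviest vertex of C: the rest of the new bag lies in Z and hence outside
   C. *)
case zC : (z \in C); last by apply: domC hg _ _; rewrite ?zC.
have hzZ : in_bag n m Z' z.
  by apply: contraNT hz => hz; move: hy; rewrite !inE => hy; apply: conn_edge hg hz.
have [/val_inj->|hzb] := split_in_bag S hzZ; first exact: umax.
by move: zC; rewrite inE => /(conn_notin g_lt); rewrite hzb.
Qed.

End Labelled.

Lemma table_complete_empty_bag key lam : 0 < m -> elimination_key key ->
  labelling lam -> table n m g R n n (empty_bag n m) (starts lam setT).
Proof.
move=> m0 hkey Hlam; rewrite -processed_empty_bag.
apply: (table_complete Hlam m0 hkey) => //; first exact: empty_bag_lt.
  exact: labelled_empty_bag.
move=> x _; split; first by rewrite -[X in _ <= X]card_ord max_card.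
(* No edge leaves a component of the whole graph, so domination is vacuous at the beginning. *)
move=> y z y'; rewrite !inE => hy hg hz.
by rewrite (conn_edge g_lt hy hg) // in_empty_bag in hz.
Qed.

Lemma table_relabel lam c : table n m g R n n (empty_bag n m) c ->
  labelling lam -> table n m g R n n (empty_bag n m) (starts lam setT).
Proof.
move=> hc Hlam.
have := table_transfer Hlam empty_bag_lt hc empty_bag_lt
  (labelled_empty_bag Hlam) (fun _ _ => erefl).
by rewrite processed_empty_bag.
Qed.

Lemma table_valid c : table n m g R n n (empty_bag n m) c ->
  exists2 lam, valid_on lam setT & starts lam setT = c.
Proof.
case/(table_sound empty_bag_lt) => lam [_]; rewrite processed_empty_bag => h1 h2.
by exists lam.
Qed.

End Table.

(** * Tree decompositions *)

Section RootedTree.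
Variables (T : finType) (F : sgraph T) (r : T).
Hypothesis F_conn : forall s t : T, connect F s t.
Hypothesis F_acyclic : forall c : seq T, ucycle F c -> size c <= 2.

Definition within (S : {set T}) : rel T := [rel a b | [&& a \in S, b \in S & F a b]].

Local Notation avoid t := (within [set~ t]).

Lemma within_sym S : symmetric (within S).
Proof. by move=> a b; rewrite /within /= adj_sym andbCA. Qed.

Lemma connect_within_sym S : connect_sym (within S).
Proof. exact/sym_connect_sym/within_sym. Qed.

Lemma connect_withinW (A B : {set T}) x y : A \subset B ->
  connect (within A) x y -> connect (within B) x y.
Proof.
move=> /subsetP sAB; apply: connect_sub => a b /and3P[ha hb hab].
by apply: connect1; rewrite /within /= !sAB.
Qed.

Lemma connect_within_in (A : {set T}) x y : x \in A ->
  connect (within A) x y -> y \in A.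
Proof.
move=> hx /connectP[p hp ->]; elim: p x hx hp => //= z p IH x hx.
by case/andP=> /and3P[_ hz _]; apply: IH.
Qed.

(* The nodes that the removal of t separates from the root, and t itself. *)
Definition below t := [set s | ~~ ((r != t) && connect (avoid t) r s)].

Lemma below_refl t : t \in below t.
Proof.
rewrite inE; apply/negP => /andP[rt /connect_within_in].
by rewrite !inE => /(_ rt); rewrite eqxx.
Qed.

Lemma below_step t s s' : s \in below t -> s != t -> s' != t -> F s s' ->
  s' \in below t.
Proof.
rewrite !inE => + st s't hF; apply: contra => /andP[-> h]; apply: connect_trans h _.
by apply: connect1; rewrite /within /= !inE s't st adj_sym.
Qed.

(** Otherwise a path from a to b off t, closed through t, would be a cycle with at least three
    nodes. *)
Lemma cut_neighbours t a b : F t a -> F t b -> a != t ->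
  connect (avoid t) a b -> a = b.
Proof.
move=> ta tb at_ /connectP[p hp eb]; case/shortenP: hp eb => p' hp' up' _ eb.
case: p' hp' up' eb => [|y p'] hp' up' eb //.
suff /F_acyclic : ucycle F [:: t, a, y & p'] by [].
have tn : t \notin a :: y :: p'.
  apply/negP => ht; have : t \in [set~ t].
    move: ht; rewrite inE => /orP[/eqP e|ht]; first by rewrite e eqxx in at_.
    have /splitPr ht' := ht; case: ht' hp' => p1 p2.
    by rewrite cat_path => /andP[_ /andP[/and3P[]]].
  by rewrite !inE eqxx.
apply/andP; split; last by rewrite cons_uniq tn.
rewrite /cycle rcons_path -[last _ _]/(last a (y :: p')) -eb adj_sym tb andbT.
rewrite -[path _ _ _]/(F t a && path F a (y :: p')) ta.
by apply: sub_path hp' => x z /and3P[].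
Qed.

Lemma first_entry (S : {set T}) s : s \in S -> exists2 t, t \in S &
  r = t \/ exists b, [/\ r \notin S, b \notin S, F b t &
                         connect (within (~: S)) r b].
Proof.
move=> hs; case/connectP: (F_conn r s) => p hp es; rewrite es in hs.
elim: p r hp hs {es} => [|y p IH] x /=; first by exists x; rewrite //; left.
case/andP=> hxy hp hl; case hx : (x \in S); first by exists x => //; left.
have [t tS [ey|[b [yS bS hbt hc]]]] := IH y hp hl.
  by exists t => //; right; exists x; split; rewrite ?hx -?ey.
exists t => //; right; exists b; split; rewrite ?hx //.
by apply: connect_trans hc; apply: connect1; rewrite /within /= !inE hx yS.
Qed.

(** A path from the root meets one of the two nodes first and avoids the other up to there, so
    distinct nodes cannot be below each other. *)
Lemma below_anti t t' : t \in below t' -> t' \in below t -> t = t'.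
Proof.
move=> h h'; apply/eqP; apply: contraT => tt'.
have E x y : x != y -> x \in below y ->
    ~ (r = x \/ exists b, [/\ r \notin [set x; y], b \notin [set x; y], F b x &
          connect (within (~: [set x; y])) r b]).
  move=> xy; rewrite inE => /negP hx [e|[b [hr hb hbx hc]]]; apply: hx.
    by rewrite e xy connect0.
  have sub : ~: [set x; y] \subset [set~ y] by rewrite setCS subsetUr.
  move: hr hb; rewrite !inE !negb_or => /andP[_ ->] /andP[_ bY].
  apply: connect_trans (connect_withinW sub hc) _; apply: connect1.
  by rewrite /within /= !inE bY xy.
have [t0 /set2P[] ->] := first_entry (set21 t t').
  by move=> H; case: (E _ _ tt' h H).
by rewrite setUC => H; case: (E t' t _ h' H); rewrite eq_sym.
Qed.

(** A path from the root that avoids t cannot meet t', which is not reachable without t; so it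
    avoids t' as well. *)
Lemma below_sub t t' : t' \in below t -> below t' \subset below t.
Proof.
move=> ht; apply/subsetP => s; rewrite !inE; apply: contra => /andP[rt hc].
have ht' x : connect (avoid t) r x -> x != t'.
  by move=> hx; apply: contraTneq ht => <-; rewrite inE rt hx.
rewrite ht' ?connect0 //=; case/connectP: hc => p hp ->.
suff E x : path (avoid t) x p -> connect (avoid t) r x ->
    connect (avoid t') x (last x p) by apply: E.
elim: p x {hp} => [|y p IH] x //=.
case/andP=> hxy hp hx; have hy := connect_trans hx (connect1 hxy).
apply: connect_trans (IH y hp hy); apply: connect1.
by case/and3P: hxy => _ _ hF; rewrite /within /= !inE !ht'.
Qed.

(** Take for t the first node of S on a path from the root, entered from b outside S. If the root
    reached some s in S without t, then the neighbour a of t on a path from s to t inside S would be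
    joined to b off t; by [cut_neighbours] a = b, although only a is in S. *)
Lemma top_exists (S : {set T}) : S != set0 ->
  {in S &, forall x y, connect (within S) x y} ->
  exists2 t, t \in S & S \subset below t.
Proof.
case/set0Pn=> s0 hs0 S_conn; have [t tS H] := first_entry hs0; exists t => //.
apply/subsetP => s sS; rewrite inE; apply/negP => /andP[rt hrs].
case: H => [e|[b [rS bS hbt hrb]]]; first by rewrite e eqxx in rt.
have st : s != t.
  by have := connect_within_in _ hrs; rewrite !inE; apply.
have [a [aS at_ hat hsa]] : exists a, [/\ a \in S, a != t, F a t & connect (avoid t) s a].
  case/connectP: (S_conn s t sS tS) => p; elim: p s sS st {hrs} => [|y p IH] x xS xt.
    by move=> _ /= e; rewrite e eqxx in xt.
  case/andP=> /and3P[_ yS hxy] hp et; case: (eqVneq y t) => [e|yt].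
    by exists x; rewrite -{2}e; split.
  have [a [h1 h2 h3 h4]] := IH y yS yt hp et; exists a; split=> //.
  by apply: connect_trans h4; apply: connect1; rewrite /within /= !inE xt yt.
have sub : ~: S \subset [set~ t] by rewrite setCS sub1set.
have : a = b.
  apply: (@cut_neighbours t) => //; rewrite 1?adj_sym //.
  rewrite connect_within_sym; apply: connect_trans hsa.
  apply: connect_trans hrs; rewrite connect_within_sym.
  exact: connect_withinW hrb.
by move=> e; rewrite -e aS in bS.
Qed.

End RootedTree.

(** Let t be the topmost node whose bag meets D, and u a vertex of D in this bag; then t is also the
    topmost node of u. A neighbour z of D that is not in the bag of t occurs only below t, so its
    topmost node is strictly below t and z weighs less than u, against the assumption. Hence all
    neighbours of D lie in the bag of t beside u. *)
Lemma elimination_key_of_decomposition (V : finType) (G : sgraph V) (T : finType)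
    (F : sgraph T) (bag : T -> {set V}) w :
  tree_decomposition G F bag -> (forall t, #|bag t| <= w.+1) ->
  exists key : V -> nat, forall D : {set V}, D != set0 ->
    {in D &, forall x y, connect [rel a b | [&& a \in D, b \in D & G a b]] x y} ->
    (forall x z x', x \in D -> G x z -> z \notin D -> x' \in D ->
       key x' <= key z) ->
    #|[set z | (z \notin D) && [exists d in D, G d z]]| <= w.
Proof.
move=> [[T0 F_conn F_acyc] bag_v bag_e bag_c] hw.
have [r _] : exists r : T, r \in T by apply/card_gt0P.
pose S v := [set t | v \in bag t].
have S_conn v : {in S v &, forall x y, connect (within F (S v)) x y}.
  move=> x y; rewrite !inE => hx hy; apply: connect_sub (bag_c v x y hx hy).
  by move=> a b /and3P[h1 h2 h3]; apply: connect1; rewrite /within /= !inE h1 h2 h3.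
have top_v v : exists t, t \in S v /\ S v \subset below F r t.
  have [|t h1 h2] := top_exists r F_conn F_acyc _ (S_conn v); last by exists t.
  by have [t ht] := bag_v v; apply/set0Pn; exists t; rewrite inE.
have [top Htop] := fin_all_exists top_v.
exists (fun v => #|below F r (top v)|) => D /set0Pn[d0 hd0] D_conn D_dom.
pose SD := \bigcup_(d in D) S d.
have S_sub d : d \in D -> S d \subset SD by move=> hd; apply: bigcup_sup.
have SD_conn : {in SD &, forall x y, connect (within F SD) x y}.
  move=> x y /bigcupP[d hd hx] /bigcupP[d' hd' hy].
  case/connectP: (D_conn d d' hd hd') => p; elim: p d hd x hx => [|e p IH] d hd x hx.
    by move=> _ ed; rewrite ed in hy; apply: connect_withinW (S_sub d hd) (S_conn d x y hx hy).
  case/andP=> /and3P[_ he hde] hp ed.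
  have [s /andP[sd se]] := bag_e _ _ hde.
  apply: connect_trans (IH e he s _ hp ed); last by rewrite inE.
  by apply: connect_withinW (S_sub d hd) (S_conn d x s hx _); rewrite inE.
have [|t tSD SDt] := top_exists r F_conn F_acyc _ SD_conn.
  have [t0 h0] := bag_v d0; apply/set0Pn; exists t0.
  by apply/bigcupP; exists d0 => //; rewrite inE.
have [u uD tu] := bigcupP tSD.
have et : top u = t.
  have [h1 h2] := Htop u; apply: (below_anti F_conn (r := r)).
    exact: subsetP (subset_trans (S_sub u uD) SDt) _ h1.
  exact: subsetP h2 _ tu.
have sub : [set z | (z \notin D) && [exists d in D, G d z]] \subset bag t :\ u.
  apply/subsetP => z; rewrite 2!inE => /andP[zD /existsP[d /andP[dD dz]]].
  rewrite !inE; apply/andP; split; first by apply: contraNneq zD => ->.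
  apply: contraT => zt; have [s /andP[sd sz]] := bag_e _ _ dz.
  have st : s \in below F r t.
    by apply: subsetP SDt _ _; apply: subsetP (S_sub d dD) _ _; rewrite inE.
  have Sz : S z \subset below F r t.
    apply/subsetP => s'; have sS : s \in S z by rewrite inE.
    move=> hs'; case/connectP: (S_conn z s s' sS hs') => p hp ->.
    elim: p s st {sd sz sS} hp => //= y p IH x hx /andP[/and3P[xS yS hF] hp].
    apply: IH hp; apply: below_step hF => //.
      by apply: contraNneq zt => <-; rewrite inE in xS.
    by apply: contraNneq zt => <-; rewrite inE in yS.
  have [h1 h2] := Htop z; have tz := subsetP Sz _ h1.
  have : below F r (top z) \proper below F r t.
    rewrite properE below_sub //=; apply/negP => /subsetP/(_ _ (below_refl F r t)) h.
    have e := below_anti F_conn tz h; rewrite e in h1.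
    by rewrite inE (negbTE zt) in h1.
  move/proper_card; rewrite ltnNge -et.
  by rewrite (D_dom d z u).
apply: leq_trans (subset_leq_card sub) _.
have := hw t; rewrite (cardsD1 u (bag t)); move: tu; rewrite inE => -> .
by rewrite add1n ltnS.
Qed.

(** * Labellings and isometric path partitions *)

Section PathLabels.
Variables (V : finType) (G : sgraph V).

Definition walk s x v := exists p, [/\ path G x p, last x p = v & size p <= s].

Lemma walkW s s' x v : s <= s' -> walk s x v -> walk s' x v.
Proof. by move=> hs [p [h1 h2 h3]]; exists p; split=> //; apply: leq_trans hs. Qed.

Lemma walkS s x u v : walk s x u -> G u v -> walk s.+1 x v.
Proof.
move=> [p [h1 h2 h3]] hg; exists (rcons p v).
by rewrite rcons_path last_rcons size_rcons h1 h2 hg.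
Qed.

Lemma walk_path s x v : walk s x v ->
  exists p, [/\ is_path G x p, last x p = v & size p <= s].
Proof.
move=> [p [hp <- hs]]; case/shortenP: hp => p' hp' up' sub; exists p'; split=> //.
by apply: leq_trans hs; apply: uniq_leq_size sub; case/andP: up'.
Qed.

Lemma path_size x p : is_path G x p -> size p < #|V|.
Proof. by case=> _ u; have := max_card (mem (x :: p)); rewrite (card_uniqP u). Qed.

(** The labels x, p, s as functions a, b, c on vertices, before they are packed into digits; the
    radius s in [label_closer] corresponds to the one in [closer]. *)
Record path_labels (a b c : V -> V) : Prop := PathLabels {
  label_start : forall v, b v = v -> a v = v;
  label_closer : forall v, b v <> v -> G (b v) v /\
    exists s, [/\ s < #|V|, walk s (a v) (b v) & ~ walk s (a v) v];
  label_succ : forall v, c v = v \/ G v (c v);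
  label_pred_eq : forall v, b v <> v -> a (b v) = a v /\ c (b v) = v;
  label_succ_eq : forall v, c v <> v -> a (c v) = a v /\ b (c v) = v }.

(** The paths are the orbits of c that begin at the fixed points of b. The distance from the start
    grows by one with every step, which makes an orbit finite up to its fixed point, free of
    repetitions and isometric. *)
Lemma partition_of_labels a b c : path_labels a b c ->
  isometric_path_partition G #|[set v | b v == v]|.
Proof.
move=> [l1 l2 l3 l4 l5].
(* Stepping back along b lowers the distance from the start and so ends there; c retraces these
   steps. *)
have trace s v : walk s (a v) v -> b (a v) = a v /\ exists j, v = iter j c (a v).
  elim: s v => [|s IH] v hw; case: (eqVneq (b v) v) => [e|/eqP ne].
  - by rewrite (l1 _ e); split=> //; exists 0.
  - case: (l2 _ ne) => _ [s' [_ _ []]]; exact: walkW hw.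
  - by rewrite (l1 _ e); split=> //; exists 0.
  case: (l2 _ ne) => _ [s' [_ h1 h2]]; have [ea ec] := l4 _ ne.
  have hs : s' <= s by rewrite leqNgt; apply/negP => hs; apply: h2; exact: walkW hw.
  have [] := IH (b v); first by rewrite ea; apply: walkW h1.
  by rewrite ea => h [j ej]; split=> //; exists j.+1; rewrite iterS -ej ec.
have start v : b (a v) = a v /\ exists j, v = iter j c (a v).
  case: (eqVneq (b v) v) => [e|/eqP ne].
    by apply: (@trace 0); rewrite (l1 _ e); exists [::].
  by case: (l2 _ ne) => hg [s [_ h1 _]]; apply: (@trace s.+1); apply: walkS hg.
(* Until the orbit stops, its j-th vertex is at distance exactly j from x. *)
have dist x j : b x = x -> (forall i, i < j -> c (iter i c x) <> iter i c x) ->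
    [/\ a (iter j c x) = x, walk j x (iter j c x) &
        forall t, walk t x (iter j c x) -> j <= t].
  move=> bx; elim: j => [|j IH] hj; first by split=> //; [exact: l1|exists [::]].
  have [|ea hw hd] := IH; first by move=> i hi; apply: hj; apply: leqW.
  have ne := hj j (ltnSn j); have [ea' eb] := l5 _ ne.
  have ne' : b (c (iter j c x)) <> c (iter j c x) by rewrite eb => e; apply: ne.
  split; first by rewrite iterS ea' ea.
    by apply: walkS hw _; case: (l3 (iter j c x)).
  move=> t ht; rewrite ltnNge; apply/negP => tj.
  case: (l2 _ ne') => _ [s [_ h1 []]]; rewrite ea' ea eb in h1 *.
  exact: walkW (leq_trans tj (hd _ h1)) ht.
have block x : b x = x -> exists p, isometric_path G x p /\
    [set v | a v == x] = [set v in x :: p].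
  move=> bx; have ex : exists r, c (iter r c x) == iter r c x.
    case: (pickP (fun r : 'I_#|V|.+1 => c (iter r c x) == iter r c x)) => [r hr|hn].
      by exists r.
    (* An orbit that does not stop would reach a vertex at distance #|V|, longer than any path. *)
    have [|_ hw hd] := dist x #|V| bx.
      by move=> i hi; have := hn (inord i); rewrite inordK ?leqW // => /eqP.
    have [p [hp e _]] := walk_path hw.
    have := hd (size p); rewrite leqNgt (path_size hp) => h.
    by exfalso; have : false by apply: h; case: hp => hp _; exists p.
  case: (ex_minnP ex) => r /eqP hr hmin.
  have mv i : i < r -> c (iter i c x) <> iter i c x.
    by move=> hi /eqP /hmin; rewrite leqNgt hi.
  have mvW j i : j <= r -> i < j -> c (iter i c x) <> iter i c x.
    by move=> hj hi; apply: mv; apply: leq_trans hj.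
  exists (traject c (c x) r).
  have eT : x :: traject c (c x) r = traject c x r.+1 by [].
  split; last first.
    apply/setP => v; rewrite !inE -in_cons eT; apply/eqP/trajectP => [e|[i hi ->]].
      have [_ [j]] := start v; rewrite e => ->.
      case: (leqP j r) => hj; first by exists j.
      exists r => //; rewrite -(subnK (ltnW hj)) iterD.
      by elim: (j - r) => // k IHk; rewrite iterS IHk hr.
    by have [] := dist x i bx (fun k => mvW i k hi).
  have [_ hw hd] := dist x r bx mv.
  split; last first.
    move=> q [hq _]; rewrite last_traject size_traject => e.
    by apply: hd; exists q.
  split; last first.
    rewrite eT looping_uniq; apply/trajectP => -[i hi e].
    have [_ hwi _] := dist x i bx (fun k => mvW i k (ltnW hi)).
    by rewrite -e in hwi; have := hd _ hwi; rewrite leqNgt hi.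
  apply/(pathP x) => i; rewrite size_traject => hi.
  rewrite eT (nth_traject _ (leqW hi)) (set_nth_default (c x)) ?size_traject //.
  rewrite (nth_traject _ hi) -iterSr iterS.
  by case: (l3 (iter i c x)) => // /(mv i hi).
pose B x := [set v | a v == x].
have Bx x : b x = x -> x \in B x by move=> bx; rewrite inE l1.
exists [set B x | x in [set v | b v == v]]; split.
- apply/and3P; split.
  + apply/eqP/setP => v; rewrite in_setT; apply/bigcupP; exists (B (a v)).
      by apply: imset_f; rewrite inE; have [-> _] := start v.
    by rewrite inE.
  + apply/trivIsetP => _ _ /imsetP[x _ ->] /imsetP[y _ ->] ne.
    rewrite disjoint_subset; apply/subsetP => v; rewrite !inE => /eqP ev.
    by apply: contra ne => /eqP; rewrite ev => ->.
  + apply/imsetP => -[x]; rewrite inE => /eqP/Bx hx e.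
    by rewrite -e inE in hx.
- apply: card_in_imset => x y; rewrite !inE => /eqP bx /eqP hy e.
  by have := Bx x bx; rewrite e inE l1 // => /eqP.
- move=> _ /imsetP[x + ->]; rewrite inE => /eqP/block[p [h1 h2]].
  by exists x, p.
Qed.

Lemma last_take_nth (x : V) p i : i <= size p ->
  last x (take i p) = nth x (x :: p) i.
Proof.
elim: p x i => [|y p IH] x [|i] //= hi; rewrite IH //.
by apply: set_nth_default; rewrite /= ltnS.
Qed.

(** A shorter walk to v could be continued along p and would reach the end of p too early. *)
Lemma isometric_dist x p v t : isometric_path G x p -> v \in x :: p ->
  walk t x v -> index v (x :: p) <= t.
Proof.
move=> [[hp up] hmin] hv [q [hq eq_ hs]]; apply: leq_trans hs.
have hi : index v (x :: p) < size (x :: p) by rewrite index_mem.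
have := nth_index x hv; move: (index v (x :: p)) hi => i; rewrite ltnS => hi ni.
have ev : last x (take i p) = v by rewrite last_take_nth.
have hd : path G v (drop i p).
  by move: hp; rewrite -{1}(cat_take_drop i p) cat_path ev => /andP[].
have hl : last v (drop i p) = last x p.
  by rewrite -{2}(cat_take_drop i p) last_cat ev.
have w : walk (size q + (size p - i)) x (last x p).
  exists (q ++ drop i p).
  by rewrite cat_path last_cat eq_ hq hd hl size_cat size_drop.
have [q' [h1 h2 h3]] := walk_path w.
by rewrite -(leq_add2r (size p - i)) subnKC //; apply: leq_trans (hmin _ h1 h2) h3.
Qed.

Lemma labels_of_partition k : isometric_path_partition G k ->
  exists a b c, path_labels a b c /\ #|[set v | b v == v]| = k.
Proof.
move=> [P [hP <- hiso]]; have [/eqP covP trivP P0] := and3P hP.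
have wP (S : {set V}) : exists w : seq V, S \in P ->
    exists x p, [/\ w = x :: p, isometric_path G x p & S = [set v in w]].
  case hS : (S \in P); last by exists [::].
  by have [x [p [h1 h2]]] := hiso S hS; exists (x :: p) => _; exists x, p.
have [w Hw] := fin_all_exists wP.
have inP v : pblock P v \in P by apply: pblock_mem; rewrite covP inE.
have vP v : v \in pblock P v by rewrite mem_pblock covP inE.
pose W v := w (pblock P v).
have memW u v : (u \in W v) = (u \in pblock P v).
  by have [x [p [_ _ e]]] := Hw _ (inP v); rewrite [in RHS]e inE.
have vW v : v \in W v by rewrite memW.
have sameW u v : u \in W v -> W u = W v.
  by rewrite memW => h; rewrite /W (def_pblock trivP (inP v) h).
have uW v : uniq (W v) by have [x [p [e [[]]]]] := Hw _ (inP v); rewrite /W e.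
pose i v := index v (W v).
have iW v : i v < size (W v) by rewrite index_mem.
have nthi v d : nth d (W v) (i v) = v by rewrite nth_index.
have indexW v u j : j < size (W v) -> i (nth u (W v) j) = j.
  by move=> hj; rewrite /i (sameW _ v) ?mem_nth // index_uniq.
have edgeW v d j : j.+1 < size (W v) -> G (nth d (W v) j) (nth d (W v) j.+1).
  have [x [p [e [[hp _] _] _]]] := Hw _ (inP v); rewrite /W e /= => hj.
  by have /(pathP d) := hp; apply.
(* At position 0 the predecessor is taken at [0.-1 = 0], and past the end [nth] returns its default
   v: in both cases the result is v itself, the mark of a start or an end. *)
exists (fun v => head v (W v)), (fun v => nth v (W v) (i v).-1),
  (fun v => nth v (W v) (i v).+1).
have b0 v : nth v (W v) (i v).-1 = v -> i v = 0.
  move=> e; have : nth v (W v) (i v).-1 == nth v (W v) (i v) by rewrite nthi e.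
  rewrite nth_uniq //; last exact: leq_ltn_trans (leq_pred _) (iW v).
  by case: (i v) => // j; rewrite ltn_eqF.
have head0 v : head v (W v) = nth v (W v) 0 by case: (W v).
have sameH u v d d' : u \in W v -> head d (W u) = head d' (W v).
  by move=> h; rewrite (sameW _ _ h); have := vW v; case: (W v).
have ipos v : nth v (W v) (i v).-1 <> v -> exists j, i v = j.+1.
  by case e : (i v) => [|j] h; [case: h; rewrite /= -e nthi|exists j].
split; first split.
- by move=> v /b0 e; rewrite head0 -e nthi.
- move=> v hv; have [j ej] := ipos v hv.
  have hj : j.+1 < size (W v) by rewrite -ej.
  have ev : nth v (W v) j.+1 = v by rewrite -ej nthi.
  split; first by rewrite ej /=; have := edgeW v v j hj; rewrite ev.
  have [x [p [e hiso' _]]] := Hw _ (inP v); rewrite -/(W v) in e.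
  (* The radius is the position j of the predecessor: the path reaches it in j steps, and v is one
     step farther because the path is isometric. *)
  exists j; split.
  + rewrite (leq_trans (ltnW hj)) // -(card_uniqP (uW v)); exact: max_card.
  + rewrite ej /= e /=; exists (take j p).
    have [[hp _] _] := hiso'; rewrite e /= ltnS in hj.
    split; first by move: hp; rewrite -{1}(cat_take_drop j p) cat_path => /andP[].
      by rewrite last_take_nth ?(ltnW hj) //; apply: set_nth_default; apply: leqW.
    by rewrite size_takel // ltnW.
  + rewrite e /= => hw; have := isometric_dist hiso' _ hw; rewrite -e => /(_ (vW v)).
    by rewrite -/(i v) ej ltnn.
- move=> v; case: (ltnP (i v).+1 (size (W v))) => h.
    by right; rewrite -{1}(nthi v v) edgeW.
  by left; rewrite nth_default.
- move=> v hv; have [j ej] := ipos v hv.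
  have hj : j < size (W v) by apply: ltnW; rewrite -ej.
  rewrite ej /=; set u := nth v (W v) j.
  have uu : u \in W v by apply: mem_nth.
  split; first exact: sameH.
  by rewrite (sameW _ _ uu) /u indexW // -ej -/u nthi.
- move=> v hv; have h : (i v).+1 < size (W v).
    by rewrite ltnNge; apply/negP => h; apply: hv; rewrite nth_default.
  set u := nth v (W v) (i v).+1.
  have uu : u \in W v by apply: mem_nth.
  split; first exact: sameH.
  by rewrite (sameW _ _ uu) /u indexW // -/u /= nthi.
(* Every block has exactly one vertex at position 0, so counting starts amounts to counting
   blocks. *)
have <- : [set pblock P v | v in [set v | nth v (W v) (i v).-1 == v]] = P.
  apply/setP => S; apply/imsetP/idP => [[v _ ->]|hS]; first exact: inP.
  have [x [p [e h1 h2]]] := Hw S hS.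
  have xS : x \in S by rewrite h2 e inE mem_head.
  have ex : pblock P x = S by apply: def_pblock.
  by exists x; rewrite // inE /i /W ex e /= eqxx.
rewrite card_in_imset // => u v; rewrite !inE => /eqP/b0 hu /eqP/b0 hv e.
have eW : W u = W v by rewrite /W e.
by rewrite -(nthi u u) -(nthi v u) hu hv eW.
Qed.

End PathLabels.

(** * Path labels and vertex codes *)

Section Encoding.
Variables (n m : nat) (g : rel nat) (G : sgraph 'I_n).
Hypothesis g_lt : forall u v, g u v -> u < n.
Hypothesis g_sym : symmetric g.
Hypothesis gE : forall u v : 'I_n, g u v = G u v.
Local Notation V := 'I_n.
Local Notation R := (ranged_reach n m g).

Lemma reach_walk s (x v : V) :
  reach n m g s x v (empty_bag n m) <-> walk G s x v.
Proof.
have e : avoiding m g (empty_bag n m) =2 G.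
  by move=> a b; rewrite /avoiding /= !in_empty_bag gE !andbT.
split=> [/(reachP m g_lt)[p [_ h1 h2 h3]]|[p [h1 h2 h3]]].
  by exists p; rewrite -(eq_path e).
by apply/(reachP m g_lt); exists p; rewrite in_empty_bag (eq_path e).
Qed.

Lemma closerP (x p v : V) : closer n m R x p v <->
  exists s, [/\ s < #|V|, walk G s x p & ~ walk G s x v].
Proof.
have rE s (y : V) : s < n ->
    R s x y (empty_bag n m) = reach n m g s x y (empty_bag n m).
  by move=> hs; rewrite ranged_reachE ?empty_bag_lt // ltnW.
rewrite card_ord; split=> [/hasP[s]|[s [hs h1 h2]]].
  rewrite mem_iota => /= hs; rewrite !rE // => /andP[/reach_walk h1 h2].
  by exists s; split=> // /reach_walk; apply/negP.
apply/hasP; exists s; first by rewrite mem_iota.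
by rewrite !rE //; apply/andP; split; [apply/reach_walk|apply/negP => /reach_walk].
Qed.

Lemma valid_partition lam : valid_on m g lam [set: V] ->
  isometric_path_partition G (starts lam [set: V]).
Proof.
move=> hv; have {}hv (v : V) := hv v (in_setT v).
(* The default v is never returned: admissibility makes all three digits vertices. *)
pose a (v : V) : V := insubd v (code_start n (lam v)).
pose b (v : V) : V := insubd v (code_pred n (lam v)).
pose c (v : V) : V := insubd v (code_succ n (lam v)).
have aE v : val (a v) = code_start n (lam v).
  rewrite val_insubd ifT //; have [e /andP[+ _] _] := hv v.
  case/orP=> [/andP[_ /eqP->]|/andP[_ /hasP[s _ /andP[+ _]]]]; first by rewrite e.
  by rewrite /ranged_reach => /andP[_ /reach_lt/andP[]].
have bE v : val (b v) = code_pred n (lam v).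
  rewrite val_insubd ifT //; have [e /andP[+ _] _] := hv v.
  by rewrite /is_start e => /orP[/andP[/eqP-> _]|/andP[/g_lt]].
have cE v : val (c v) = code_succ n (lam v).
  rewrite val_insubd ifT //; have [e /andP[_ +] _] := hv v.
  by rewrite e => /orP[/eqP->|]; rewrite // g_sym => /g_lt.
have g_irr (v : V) : g v v = false by move: (adj_irrefl G v); rewrite -gE.
have compat (v u : V) : g v u -> compatible n (lam v) (lam u).
  by move=> h; have [_ _ /(_ u h)/andP[]] := hv v.
have -> : starts lam [set: V] = #|[set v | b v == v]|.
  rewrite /starts -sum1_card [LHS]big_mkcond [RHS]big_mkcond.
  apply: eq_bigr => v _; rewrite !inE -val_eqE /= bE /is_start.
  by have [-> _ _] := hv v; case: eqP.
apply: (@partition_of_labels _ G a b c); split.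
- move=> v ev; have [e /andP[+ _] _] := hv v.
  rewrite e -bE ev g_irr orbF => /andP[_ /eqP h].
  by apply: val_inj; rewrite aE.
- move=> v /eqP ne; have [e /andP[+ _] _] := hv v.
  rewrite /is_start e -bE -aE val_eqE (negbTE ne) /= => /andP[hg hc].
  by rewrite -gE; split=> //; apply/closerP.
- move=> v; have [e /andP[_ +] _] := hv v.
  by rewrite e -cE -gE => /orP[/eqP/val_inj|]; [left|right].
- move=> v /eqP ne; have [e /andP[+ _] _] := hv v.
  rewrite /is_start e -bE val_eqE (negbTE ne) /= => /andP[hg _].
  have := compat v (b v); rewrite g_sym => /(_ hg)/andP[+ _].
  have [e' _ _] := hv (b v); rewrite /compatible e e' -!bE eqxx val_eqE ne /=.
  by case/andP=> /eqP h1 /eqP h2; split; apply: val_inj; rewrite ?aE ?cE.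
- move=> v /eqP ne; have [e /andP[_ +] _] := hv v.
  rewrite e -cE val_eqE (negbTE ne) /= => hg.
  have := compat v (c v) hg => /andP[_ +].
  have [e' _ _] := hv (c v); rewrite /compatible e e' -!cE eqxx val_eqE ne /=.
  by case/andP=> /eqP h1 /eqP h2; split; apply: val_inj; rewrite ?aE ?bE.
Qed.

Definition pack (v x p s : nat) :=
  n.+1 * (n.+1 * (n.+1 * s + p) + x) + v.

Lemma pack_lt v x p s : v <= n -> x <= n -> p <= n -> s <= n ->
  pack v x p s < code_base n.
Proof.
move=> hv hx hp hs; rewrite /pack /code_base.
by do 2!apply: ltn_mulD_exp => //; apply: (@ltn_mulD_exp _ _ _ 1).
Qed.

Lemma packK v x p s : v <= n -> x <= n -> p <= n -> s <= n ->
  [/\ code_vertex n (pack v x p s) = v, code_start n (pack v x p s) = x,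
      code_pred n (pack v x p s) = p & code_succ n (pack v x p s) = s].
Proof.
move=> hv hx hp hs; rewrite /code_vertex /code_start /code_pred /code_succ /pack.
by rewrite !digitMS ?digitM // /digit divn1 modn_small.
Qed.

Lemma labelling_of_partition k : isometric_path_partition G k ->
  exists2 lam, labelling n m g lam & starts lam [set: V] = k.
Proof.
move=> /labels_of_partition[a [b [c [[l1 l2 l3 l4 l5] <-]]]].
pose lam (v : nat) := if (insub v : option V) is Some u then pack u (a u) (b u) (c u)
              else (code_base n).-1.
have lamE (u : V) : lam u = pack u (a u) (b u) (c u) by rewrite /lam valK.
have ule (u : V) : u <= n by apply: ltnW.
have K (u : V) := packK (ule u) (ule (a u)) (ule (b u)) (ule (c u)).
exists lam; last first.
  rewrite /starts -sum1_card [LHS]big_mkcond [RHS]big_mkcond.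
  apply: eq_bigr => v _; rewrite !inE -val_eqE /= lamE /is_start.
  by have [-> _ -> _] := K v; case: eqP.
split.
- move=> v _; rewrite /lam; case: insubP => [u _ _|_]; first exact: pack_lt.
  by rewrite prednK ?code_base_gt0.
- by rewrite /lam insubN // ltnn.
move=> v _; rewrite lamE; have [kv ka kb kc] := K v; split=> //.
  apply/andP; split; rewrite /is_start kv ?ka ?kb ?kc; last first.
    by case: (l3 v) => [->|h]; rewrite ?eqxx // gE h orbT.
  case: (eqVneq (b v) v) => [e|/eqP ne].
    by rewrite (l1 _ e) e !eqxx.
  have [h1 h2] := l2 _ ne; apply/orP; right; rewrite gE h1; exact/closerP.
have C (u w : V) : compatible n (pack u (a u) (b u) (c u)) (pack w (a w) (b w) (c w)).
  rewrite /compatible; have [-> -> -> ->] := K u; have [-> -> -> ->] := K w.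
  apply/andP; split; apply/implyP => /andP[/eqP/val_inj e ne].
    have [|h1 h2] := l4 u; first by rewrite e; apply/eqP; rewrite -val_eqE.
    by rewrite -e h1 h2 !eqxx.
  have [|h1 h2] := l5 u; first by rewrite e; apply/eqP; rewrite -val_eqE.
  by rewrite -e h1 h2 !eqxx.
by move=> u _; rewrite lamE !C.
Qed.

(** The reference solution for the test of m; for a graph without edges it is also the only
    solution. *)
Lemma trivial_partition : isometric_path_partition G n.
Proof.
exists [set [set v] | v in setT]; split.
- apply/and3P; split.
  + apply/eqP/setP => v; rewrite in_setT; apply/bigcupP; exists [set v].
      exact: imset_f.
    by rewrite inE.
  + apply/trivIsetP => _ _ /imsetP[x _ ->] /imsetP[y _ ->] ne.
    by rewrite disjoints1 inE; apply: contra ne => /eqP->.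
  + by apply/imsetP => -[x _ /setP/(_ x)]; rewrite !inE eqxx.
- by rewrite card_imset ?cardsT ?card_ord //; apply: set1_inj.
- move=> _ /imsetP[x _ ->]; exists x, [::]; split; first by [].
  by apply/setP => y; rewrite !inE.
Qed.

End Encoding.

(** Justifies the answer no for every k > n; such a k need not fit into a digit of an address. *)
Lemma partition_card n (G : sgraph 'I_n) k :
  isometric_path_partition G k -> k <= n.
Proof.
move=> [P [hP <- _]]; rewrite -[X in _ <= X]card_ord -cardsT.
have /and3P[_ tP P0] := hP; rewrite (card_partition hP) -sum1_card.
apply: leq_sum => S hS; rewrite card_gt0.
by apply: contraNneq P0 => <-.
Qed.

(** * The main loop *)

(** The states of the main loop, with the width in register 1 and the current address in register 4;
    [ins_ok] supplies what [sized] asks for. *)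
Record instance := Instance {
  ins_inp : seq nat;
  ins_width : nat;
  ins_heap : nat -> nat;
  ins_addr : nat;
  ins_ok : [/\ 0 < nth 0 ins_inp 0,
    nth 0 ins_inp 2 <= cell_count (nth 0 ins_inp 0) ins_width &
    ins_addr <= cell_count (nth 0 ins_inp 0) ins_width] }.

Definition instance_ctx : ctx :=
  @Ctx instance ins_inp ins_heap
    (fun x => cell_count (nth 0 (ins_inp x) 0) (ins_width x))
    [:: ins_width; ins_addr].

Lemma sized_instance : @sized instance_ctx ins_width.
Proof.
split=> [|x|x|x] //; [exact: (@computable_var instance_ctx 0)|..];
  by case: x => inp w h a [].
Qed.

Lemma computable_ins_addr : @computable instance_ctx ins_addr.
Proof. exact: (@computable_var instance_ctx 1). Qed.

Lemma computable_cell_count :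
  @computable instance_ctx (fun x => cell_count (vcount x) (ins_width x)).
Proof.
have W := sized_instance; apply: computable_exp => [x|x||].
- exact: (bag_bound_le W).
- exact: leq_trans (bound_ge16 W x).
- exact: computable_bag_bound.
- exact: computable_const.
Qed.

Lemma computable_final_cell (f : instance_ctx -> nat) : computable f ->
  @computable instance_ctx (fun x => cheap x (addr (vcount x) (ins_width x) 1
    (vcount x) (vcount x) (f x) (empty_bag (vcount x) (ins_width x)))).
Proof.
move=> hf; have W := sized_instance; have cn := computable_order instance_ctx.
apply: computable_heap; apply: (computable_addr W) => //.
  exact: computable_const.
exact/computable_pred/computable_bag_bound.
Qed.

Definition heap_addr e := EAdd (EConst 1) (EAdd e e).

Lemma exec_incr inp r m v : m r.*2 = v ->
  exec inp (set_reg r (EAdd (reg r) (EConst 1))) m 6 (update m r.*2 v.+1).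
Proof.
move=> <-; rewrite -(addn1 (m r.*2)).
exact: (exec_set_reg inp r (EAdd (reg r) (EConst 1))).
Qed.

Lemma exec_copy inp r r' m v : m r'.*2 = v ->
  exec inp (set_reg r (reg r')) m 4 (update m r.*2 v).
Proof. by move=> <-; apply: (exec_set_reg inp r (reg r')). Qed.

(** Cells left over from a smaller width do no harm: a cell is computed from cells at smaller
    addresses, which have been rewritten by then. *)
Lemma table_filled :
  exists (c : cmd) (K : nat), forall inp w m,
  let n := nth 0 inp 0 in let L := cell_count n w.+1 in
  0 < n -> nth 0 inp 2 <= L -> m 1.*2 = w ->
  exists t m', [/\ exec inp c m t m', t <= polyb K L, m' 1.*2 = w.+1 &
    forall a, a < L -> m' a.*2.+1 = cell n w.+1 (input_adj inp) a].
Proof.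
have W := sized_instance.
have [cL [KL HL]] : exists (c : cmd) (K : nat), forall (x : instance_ctx) m,
    stores [:: 1; 4] x m -> exists t m', [/\ exec (cinp x) c m t m',
      t <= polyb K (cbound x), m' 5.*2 = cell_count (vcount x) (ins_width x)
      & agree 5 m m'] by case: computable_cell_count; apply.
have [cS [KS HS]] : exists (c : cmd) (K : nat), forall (x : instance_ctx) m,
    stores [:: 1; 4] x m -> exists t m', [/\ exec (cinp x) c m t m',
      t <= polyb K (cbound x), m' 5.*2 = cell_step (vcount x) (ins_width x)
        (input_adj (cinp x)) (cheap x) (ins_addr x) & agree 5 m m'].
  have [] := computable_cell_step W computable_ins_addr.
    by case=> inp w h a [].
  by apply.
(* Register 3 holds the number of cells, register 4 the next address and register 5 the value just
   computed. *)
pose body := CSeq cS (CSeq (CStore (heap_addr (reg 4)) (reg 5))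
  (set_reg 4 (EAdd (reg 4) (EConst 1)))).
pose loop := CWhile (ESub (reg 3) (reg 4)) body.
exists (CSeq (set_reg 1 (EAdd (reg 1) (EConst 1))) (CSeq (set_reg 4 (EConst 0))
  (CSeq cL (CSeq (set_reg 3 (reg 5)) loop)))).
exists (KL + (KS + 40).+1 + 40) => inp w m n L n0 hE hw.
have Hloop j i m1 : i + j = L -> m1 1.*2 = w.+1 -> m1 3.*2 = L -> m1 4.*2 = i ->
    (forall a, a < i -> m1 a.*2.+1 = cell n w.+1 (input_adj inp) a) ->
    exists t m2, [/\ exec inp loop m1 t m2, t <= j * (polyb KS L + 40) + 10,
      m2 1.*2 = w.+1 & forall a, a < L -> m2 a.*2.+1 = cell n w.+1 (input_adj inp) a].
  elim: j i m1 => [|j IH] i m1 hij h1 h3 h4 hc.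
    exists 6, m1; split=> //; last by rewrite -hij addn0.
    by apply: exec_WhileF; rewrite /= h3 h4 -hij; lia.
  have iL : i < L by lia.
  have ok : [/\ 0 < nth 0 inp 0, nth 0 inp 2 <= cell_count (nth 0 inp 0) w.+1
    & i <= cell_count (nth 0 inp 0) w.+1] by split=> //; apply: ltnW.
  pose x : instance_ctx := @Instance inp w.+1 (fun a => m1 a.*2.+1) i ok.
  have [t [m2 [e1 e2 e3 e4]]] : exists t m', [/\ exec inp cS m1 t m',
      t <= polyb KS L, m' 5.*2 = cell n w.+1 (input_adj inp) i & agree 5 m1 m'].
    have [|t [m2 [e1 e2 e3 e4]]] := HS x m1.
      by split=> // -[|[|k]].
    by exists t, m2; split=> //; rewrite e3 /= cell_step_correct.
  pose m3 := update m2 i.*2.+1 (m2 5.*2).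
  pose m4 := update m3 4.*2 i.+1.
  have h4' : m2 4.*2 = i by rewrite e4.
  have ev : eval inp m2 (heap_addr (reg 4)) = i.*2.+1.
    by rewrite /= h4' add1n addnn.
  have odd_even a b : (a.*2 == b.*2.+1) = false.
    by apply/negbTE/negP => /eqP/(congr1 odd); rewrite /= !odd_double.
  have even_odd a b : (b.*2.+1 == a.*2) = false by rewrite eq_sym odd_even.
  have r4 a : a < 5 -> a != 4 -> m4 a.*2 = m1 a.*2.
    move=> ha hne; rewrite /m4 update_reg 1?eq_sym // /m3 /update odd_even.
    by rewrite e4 // ltn_double ha.
  have [t5 [m5 [k1 k2 k3 k4]]] : exists t m2, [/\ exec inp loop m4 t m2,
      t <= j * (polyb KS L + 40) + 10, m2 1.*2 = w.+1 &
      forall a, a < L -> m2 a.*2.+1 = cell n w.+1 (input_adj inp) a].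
    apply: (IH i.+1); [by lia|by rewrite r4|by rewrite r4|exact: update_same|].
    move=> a; rewrite ltnS leq_eqVlt => ha; rewrite /m4 /update even_odd /m3 /update.
    rewrite eqSS (inj_eq double_inj); case: eqVneq ha => [-> _|_ /= ha]; first exact: e3.
    by rewrite e4 ?hc //= odd_double orbT.
  exists (5 + (t + (10 + 6).+1).+1 + t5).+1, m5; split=> //.
  + apply: exec_WhileT k1; first by rewrite /= h3 h4; lia.
    apply: exec_Seq e1 _; apply: (@exec_Seq _ _ _ _ _ m3).
      by have := exec_Store inp (heap_addr (reg 4)) (reg 5) m2; rewrite ev.
    by apply: exec_incr; rewrite /m3 /update odd_even.
  + by rewrite mulSn; lia.
pose m1 := update m 1.*2 w.+1; pose m2 := update m1 4.*2 0.
have ok : [/\ 0 < nth 0 inp 0, nth 0 inp 2 <= cell_count (nth 0 inp 0) w.+1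
    & 0 <= cell_count (nth 0 inp 0) w.+1] by [].
pose x : instance_ctx := @Instance inp w.+1 (fun a => m2 a.*2.+1) 0 ok.
have [t3 [m3 [e1 e2 e3 e4]]] : exists t m', [/\ exec inp cL m2 t m',
    t <= polyb KL L, m' 5.*2 = L & agree 5 m2 m'].
  by apply: (HL x m2); split=> // -[|[|k]].
pose m4 := update m3 3.*2 L.
have [t5 [m5 [k1 k2 k3 k4]]] : exists t m', [/\ exec inp loop m4 t m',
    t <= L * (polyb KS L + 40) + 10, m' 1.*2 = w.+1 &
    forall a, a < L -> m' a.*2.+1 = cell n w.+1 (input_adj inp) a].
  by apply: (Hloop L 0) => //; rewrite /m4 ?update_same ?update_reg // e4.
exists (6 + (3 + (t3 + (4 + t5).+1).+1).+1).+1, m5; split=> //.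
- apply: (@exec_Seq _ _ _ _ _ m1).
    exact: exec_incr.
  apply: (@exec_Seq _ _ _ _ _ m2); first exact: exec_set_reg.
  by apply: exec_Seq e1 _; apply: exec_Seq k1; apply: exec_copy.
- have h1 : polyb KS L + 40 <= polyb (KS + 40) L.
    by apply: leq_trans (polybD _ _ _); rewrite leq_add2l leq_const_polyb.
  have h2 := polybM (KS + 40) (leqnn L).
  have h3 := leq_mul (leqnn L) h1.
  apply: leq_trans (polybD _ _ _).
  have := leq_const_polyb 40 L; have := polybD KL (KS + 40).+1 L; lia.
Qed.

Definition final_table (inp : seq nat) (w c : nat) : bool :=
  let n := nth 0 inp 0 in
  table n w (input_adj inp) (ranged_reach n w (input_adj inp)) n n (empty_bag n w) c.

Lemma leq_cell_count n w w' : w <= w' -> cell_count n w <= cell_count n w'.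
Proof.
by move=> h; rewrite leq_exp2r // leq_pexp2l // code_base_gt0.
Qed.

Lemma cell_final n w g c : 0 < n -> c <= n ->
  let a := addr n w 1 n n c (empty_bag n w) in
  a < cell_count n w /\
  cell n w g a = table n w g (ranged_reach n w g) n n (empty_bag n w) c.
Proof.
move=> n0 hc a; have nN := ltn_n_bag_bound n w.
have hr : in_range n w n n c (empty_bag n w).
  by rewrite /in_range nN (leq_ltn_trans hc nN) empty_bag_lt.
have N1 : 1 < bag_bound n w by apply: leq_ltn_trans nN.
split; first exact: addr_lt.
by have [e1 e2 e3 e4 e5] := addrK hr N1; rewrite /cell e1 e2 e3 e4 e5.
Qed.

(** The widths 1, 2, ... are tried until register 2 reports that the trivial partition was derived;
    the last table then answers for k. Every round is charged at the price of the last one, hence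
    the factor [W.+1]. *)
Lemma search_program :
  exists (c : cmd) (K : nat), forall inp W,
  let n := nth 0 inp 0 in let k := nth 0 inp 1 in
  0 < n -> nth 0 inp 2 <= cell_count n 1 ->
  (forall w, w < W -> ~~ final_table inp w.+1 n) -> final_table inp W.+1 n ->
  exists t m', [/\ exec inp c memory0 t m',
    t <= W.+1 * polyb K (cell_count n W.+1) &
    m' 0 = (k <= n) && final_table inp W.+1 k].
Proof.
have [cF [KF HF]] := table_filled.
have [cD [KD HD]] : exists (c : cmd) (K : nat), forall (x : instance_ctx) m,
    stores [:: 1; 4] x m -> exists t m', [/\ exec (cinp x) c m t m',
      t <= polyb K (cbound x),
      m' 5.*2 = cheap x (addr (vcount x) (ins_width x) 1
        (vcount x) (vcount x) (vcount x) (empty_bag (vcount x) (ins_width x)))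
      & agree 5 m m'].
  by case: (computable_final_cell (computable_order instance_ctx)); apply.
have [cA [KA HA]] : exists (c : cmd) (K : nat), forall (x : instance_ctx) m,
    stores [:: 1; 4] x m -> exists t m', [/\ exec (cinp x) c m t m',
      t <= polyb K (cbound x),
      m' 5.*2 = (nth 0 (cinp x) 1 <= vcount x) &&
        (cheap x (addr (vcount x) (ins_width x) 1 (vcount x) (vcount x)
          (nth 0 (cinp x) 1) (empty_bag (vcount x) (ins_width x))) != 0)
      & agree 5 m m'].
  have ck : @computable instance_ctx (fun x => nth 0 (cinp x) 1).
    exact/computable_input/computable_const.
  suff [] : @computable instance_ctx (fun x => (nth 0 (cinp x) 1 <= vcount x) &&
      (cheap x (addr (vcount x) (ins_width x) 1 (vcount x) (vcount x)
        (nth 0 (cinp x) 1) (empty_bag (vcount x) (ins_width x))) != 0)) by apply.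
  apply: computable_andb; first exact: computable_leq (computable_order _).
  apply/computable_negb/computable_eq; last exact: computable_const.
  exact: computable_final_cell.
pose body := CSeq cF (CSeq (set_reg 4 (EConst 0)) (CSeq cD (set_reg 2 (reg 5)))).
pose loop := CWhile (ESub (EConst 1) (reg 2)) body.
exists (CSeq loop (CSeq (set_reg 4 (EConst 0)) (CSeq cA (set_reg 0 (reg 5))))).
exists (KF + KD + KA + 60) => inp W n k n0 hE hno hyes.
have edges w : nth 0 inp 2 <= cell_count n w.+1.
  exact: leq_trans hE (leq_cell_count _ _).
set L := cell_count n W.+1.
have ok w : w <= W -> [/\ 0 < nth 0 inp 0,
    nth 0 inp 2 <= cell_count (nth 0 inp 0) w.+1
    & 0 <= cell_count (nth 0 inp 0) w.+1] by [].
have Hbody w m : w <= W -> m 1.*2 = w -> exists t m', [/\ exec inp body m t m',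
    t <= polyb KF L + polyb KD L + 20, m' 1.*2 = w.+1,
    m' 2.*2 = final_table inp w.+1 n &
    forall a, a < cell_count n w.+1 -> m' a.*2.+1 = cell n w.+1 (input_adj inp) a].
  move=> wW hw; have wL : cell_count n w.+1 <= L by apply: leq_cell_count.
  have [t1 [m1 [e1 e2 e3 e4]]] := HF inp w m n0 (edges w) hw.
  pose m2 := update m1 4.*2 0.
  have m2E a : m2 a.*2.+1 = m1 a.*2.+1.
    by rewrite /m2 (agree_update m1 0 (leqnn 4)) //= odd_double orbT.
  pose x : instance_ctx := Instance (fun a => m2 a.*2.+1) (ok w wW).
  have [|t3 [m3 [h1 h2 h3 h4]]] := HD x m2.
    by split=> // -[|[|j]] // _; rewrite /m2 update_reg.
  have [hlt hcell] := cell_final w.+1 (input_adj inp) n0 (leqnn n).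
  have e5 : m3 5.*2 = final_table inp w.+1 n.
    by rewrite h3 /= m2E e4 // hcell.
  exists (t1 + (3 + (t3 + 4).+1).+1).+1, (update m3 2.*2 (final_table inp w.+1 n)).
  split.
  - apply: exec_Seq e1 _; apply: (@exec_Seq _ _ _ _ _ m2); first exact: exec_set_reg.
    by apply: exec_Seq h1 _; apply: exec_copy.
  - have b1 : t1 <= polyb KF L by apply: leq_trans e2 (leq_polyb KF wL).
    have b2 : t3 <= polyb KD L by apply: leq_trans h2 (leq_polyb KD wL).
    by clear -b1 b2; lia.
  - by rewrite update_reg // h4 // /m2 update_reg.
  - by rewrite update_same.
  - move=> a ha; rewrite (agree_update m3 _ (leqnn 2)) ?h4 ?m2E ?e4 //=;
      by rewrite odd_double orbT.
have Hloop j w m : w + j = W -> m 1.*2 = w -> m 2.*2 = 0 ->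
    exists t m', [/\ exec inp loop m t m',
      t <= j.+1 * (polyb KF L + polyb KD L + 40), m' 1.*2 = W.+1 &
      forall a, a < L -> m' a.*2.+1 = cell n W.+1 (input_adj inp) a].
  elim: j w m => [|j IH] w m hwj h1 h2.
    have ew : w = W by rewrite -hwj addn0.
    rewrite ew in h1; have [t [m' [e1 e2 e3 e4 e5]]] := Hbody W m (leqnn W) h1.
    exists (4 + t + 5).+1, m'; split=> //; last by lia.
    apply: exec_WhileT e1 _; first by rewrite /= h2.
    by apply: exec_WhileF; rewrite /= e4 hyes.
  have wW : w < W by rewrite -hwj -addSnnS leq_addr.
  have [t [m' [e1 e2 e3 e4 _]]] := Hbody w m (ltnW wW) h1.
  have hw' : w.+1 + j = W by rewrite addSnnS.
  have h2' : m' 2.*2 = 0 by rewrite e4 (negbTE (hno w wW)).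
  have [t' [m2 [k1 k2 k3 k4]]] := IH w.+1 m' hw' e3 h2'.
  exists (4 + t + t').+1, m2; split=> //; last by rewrite [j.+2 * _]mulSn; lia.
  by apply: exec_WhileT e1 k1; rewrite /= h2.
have [t1 [m1 [e1 e2 e3 e4]]] := Hloop W 0 memory0 (add0n W) erefl erefl.
pose m2 := update m1 4.*2 0.
have m2E a : m2 a.*2.+1 = m1 a.*2.+1.
  by rewrite /m2 (agree_update m1 0 (leqnn 4)) //= odd_double orbT.
pose x : instance_ctx := Instance (fun a => m2 a.*2.+1) (ok W (leqnn W)).
have [|t3 [m3 [h1 h2 h3 h4]]] := HA x m2.
  by split=> // -[|[|j]] // _; rewrite /m2 update_reg.
exists (t1 + (3 + (t3 + 4).+1).+1).+1, (update m3 0.*2 (m3 5.*2)); split.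
- apply: exec_Seq e1 _; apply: (@exec_Seq _ _ _ _ _ m2); first exact: exec_set_reg.
  by apply: exec_Seq h1 _; apply: exec_copy.
- have b3 : t3 <= polyb KA L := h2.
  have q1 : polyb KF L + polyb KD L + polyb KA L + 60 <= polyb (KF + KD + KA + 60) L.
    apply: leq_trans (polybD _ _ _); apply: leq_add (leq_const_polyb _ _).
    by apply: leq_trans (polybD _ _ _); rewrite leq_add2r polybD.
  apply: leq_trans (leq_mul (leqnn W.+1) q1).
  apply: (@leq_trans (W.+1 * (polyb KF L + polyb KD L + 40) + (polyb KA L + 20))).
    by lia.
  apply: (@leq_trans (W.+1 * (polyb KF L + polyb KD L + 40) + W.+1 * (polyb KA L + 20))).
    by rewrite leq_add2l leq_pmull.
  by rewrite -mulnDr leq_mul2l; apply/orP; right; lia.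
- rewrite -[X in update _ _ _ X]/(0.*2) update_same h3 /= -/n -/k.
  case: leqP => //= hk; have [hlt hcell] := cell_final W.+1 (input_adj inp) n0 hk.
  by rewrite m2E e4 // hcell eqb0 negbK.
Qed.

(** * Running time and correctness *)

Lemma nth_flatten_pairs n (l : seq ('I_n * 'I_n)) d e : e < size l ->
  let F := flatten [seq [:: val uv.1; val uv.2] | uv <- l] in
  nth 0 F (e + e) = (nth d l e).1 /\ nth 0 F (e + e).+1 = (nth d l e).2.
Proof.
by elim: l e => [|uv s IH] // [|e] //= he; rewrite addnS; apply: IH.
Qed.

Section Input.
Variables (n : nat) (G : sgraph 'I_n) (k : nat) (l : seq ('I_n * 'I_n)).
Hypothesis Gl : edge_list G l.

Lemma nth_encode d e : e < size l ->
  nth 0 (encode l k) (3 + (e + e)) = (nth d l e).1 /\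
  nth 0 (encode l k) (4 + (e + e)) = (nth d l e).2.
Proof.
exact: nth_flatten_pairs.
Qed.

Lemma input_adjP u v : reflect (exists2 e, e \in l &
    (val e.1, val e.2) = (u, v) \/ (val e.1, val e.2) = (v, u))
  (input_adj (encode l k) u v).
Proof.
apply: (iffP hasP) => [[e]|[[a b] he H]].
  rewrite mem_iota => he0; have he : e < size l := he0.
  have d : 'I_n * 'I_n by case: l he => [//|x s _].
  have [-> ->] := nth_encode d he; move=> H; exists (nth d l e); first exact: mem_nth.
  by case/orP: H => /andP[/eqP<- /eqP<-]; [left|right].
have hi : index (a, b) l < size l by rewrite index_mem.
exists (index (a, b) l); first by rewrite mem_iota.
have [-> ->] := nth_encode (a, b) hi; rewrite nth_index //=.
by case: H => -[-> ->]; rewrite !eqxx ?orbT.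
Qed.

Lemma mem_edge u v : ((u, v) \in l) || ((v, u) \in l) = G u v.
Proof.
have := Gl u v; rewrite -!has_pred1 !has_count.
by case: (G u v) => /=; case: (count_mem (u, v) l) (count_mem (v, u) l) => [|x] [|y].
Qed.

Lemma input_adjE (u v : 'I_n) : input_adj (encode l k) u v = G u v.
Proof.
rewrite -mem_edge; apply/input_adjP/orP => [[[a b] he]|].
  by case=> -[/val_inj ea /val_inj eb]; rewrite ea eb in he; [left|right].
by case=> h; [exists (u, v)|exists (v, u)] => //; [left|right].
Qed.

Lemma input_adj_lt u v : input_adj (encode l k) u v -> u < n.
Proof.
by case/input_adjP=> -[a b] _ []; case=> [ea eb]; rewrite -?ea -?eb ltn_ord.
Qed.

Lemma input_adj_sym : symmetric (input_adj (encode l k)).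
Proof.
suff H u v : input_adj (encode l k) u v -> input_adj (encode l k) v u.
  by move=> u v; apply/idP/idP; apply: H.
by case/input_adjP=> e he H; apply/input_adjP; exists e => //; case: H; [right|left].
Qed.

Lemma input_adj_irr : irreflexive (input_adj (encode l k)).
Proof.
move=> u; apply/negbTE/negP => h; have hu := input_adj_lt h; move: h.
by rewrite -[u]/(val (Ordinal hu)) input_adjE adj_irrefl.
Qed.

Lemma edge_list_size : size l <= n * n.
Proof.
have ul : uniq l.
  apply: count_mem_uniq => -[u v]; have := Gl u v; rewrite -has_pred1 has_count.
  by case: (G u v); case: (count_mem (u, v) l) => [|[|x]] //=; case: (count_mem _ _).
by rewrite -(card_uniqP ul) -[X in _ <= X * _]card_ord -[X in _ <= _ * X]card_ord
  -card_prod max_card.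
Qed.

End Input.

Lemma treewidthP (V : finType) (G : sgraph V) :
  has_width G (treewidth G) /\ forall w, has_width G w -> treewidth G <= w.
Proof.
rewrite /treewidth; case: ex_minnP => w /asboolP h1 h2; split=> // w' hw'.
by apply: h2; apply/asboolP.
Qed.

(** For n = 0 the time bound is positive only because the exponent vanishes and 0 ^ 0 = 1. *)
Lemma treewidth_void (G : sgraph 'I_0) : treewidth G = 0.
Proof.
apply/eqP; rewrite -leqn0; have [_] := treewidthP G; apply.
have sym : symmetric [rel _ _ : unit | false] by [].
have irr : irreflexive [rel _ _ : unit | false] by [].
exists unit, (SGraph sym irr), (fun=> set0); split; last first.
  by rewrite /width big1 // => t _; rewrite cards0.
split=> [|[]|[]|[]] //; split=> [|[] []|]; rewrite ?card_unit ?connect0 //.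
by case=> [|x [|y c]].
Qed.

Lemma treewidth_edge (V : finType) (G : sgraph V) u v : G u v -> 0 < treewidth G.
Proof.
move=> guv; rewrite lt0n; apply/eqP => tw0.
have [[T [F [bag [[_ _ hb _] hw]]]] _] := treewidthP G.
have [t /andP[ut vt]] := hb _ _ guv.
have : #|bag t| <= 1.
  apply: leq_trans (@leq_bigmax _ (fun t => #|bag t|) t) _; move: hw; rewrite tw0 /width.
  by case: (\max_(i : T) _) => [|[|x]].
rewrite leqNgt; apply/negP/negPn/card_gt1P; exists u, v; split=> //.
by apply: contraTneq guv => ->; rewrite adj_irrefl.
Qed.

Lemma edgeless_partition n (G : sgraph 'I_n) k : (forall u v, G u v = false) ->
  isometric_path_partition G k <-> k = n.
Proof.
move=> hG; split=> [[P [hP <- hiso]]|->]; last exact: trivial_partition.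
have := card_partition hP; rewrite cardsT card_ord => e; rewrite [RHS]e.
rewrite -sum1_card; apply: eq_bigr => S /hiso[x [p [[[hp _] _] ->]]].
case: p hp => [|y p] /=; last by rewrite hG.
by move=> _; apply/esym/eqP/cards1P; exists x; apply/setP => y; rewrite !inE.
Qed.

Section Threshold.
Variables (n : nat) (G : sgraph 'I_n) (k : nat) (l : seq ('I_n * 'I_n)).
Hypothesis Gl : edge_list G l.
Local Notation inp := (encode l k).

(** Nothing relates w to the treewidth: soundness holds for all w, and completeness is obtained by
    relabelling the derivation for n. *)
Lemma final_table_correct w c : final_table inp w n ->
  final_table inp w c <-> isometric_path_partition G c.
Proof.
have g_sym := @input_adj_sym n k l; have g_lt := @input_adj_lt n k l.
have g_irr := input_adj_irr k Gl; have gE := input_adjE k Gl.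
move=> hn; split.
  case/(table_valid g_sym g_lt g_irr) => lam h1 <-.
  exact: (valid_partition g_lt g_sym gE h1).
move/(labelling_of_partition w g_lt gE) => [lam h1 <-].
exact: (table_relabel g_sym g_lt hn h1).
Qed.

Lemma final_table_treewidth : 0 < treewidth G -> final_table inp (treewidth G) n.
Proof.
move=> tw0; have g_sym := @input_adj_sym n k l; have g_lt := @input_adj_lt n k l.
have gE := input_adjE k Gl.
have [[T [F [bag [hdec hw]]]] _] := treewidthP G.
have hbag t : #|bag t| <= (treewidth G).+1.
  apply: leq_trans (@leq_bigmax _ (fun t => #|bag t|) t) _; rewrite -hw /width.
  exact: leqSpred.
have [key Hkey] := elimination_key_of_decomposition hdec hbag.
have hk : elimination_key (treewidth G) (input_adj inp) key.
  move=> D D0 Dc Dd; rewrite /boundary.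
  have -> : [set z | (z \notin D) && [exists d in D, input_adj inp (val d) (val z)]]
      = [set z | (z \notin D) && [exists d in D, G d z]].
    by apply/setP => z; rewrite !inE; congr andb; apply: eq_existsb => d; rewrite gE.
  apply: Hkey => // [x y xD yD|x z x' xD hxz]; last by apply: Dd xD _; rewrite gE.
  rewrite -(eq_connect (e := inside (input_adj inp) D)); first exact: Dc.
  by move=> a b; rewrite /inside /= gE.
have [lam h1 h2] := labelling_of_partition (treewidth G) g_lt gE (trivial_partition G).
have := table_complete_empty_bag g_sym g_lt tw0 hk h1.
by rewrite h2.
Qed.
End Threshold.

(** With n.+1 <= n ^ 2 and w.+1 <= 2 * w, the exponent 4 * w.+1 * 5 of n.+1 becomes at most 80 * w
    for n; the successor costs a factor 2 <= n and so one more w. *)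
Lemma cell_count_exp n w : 1 < n -> 0 < w -> (cell_count n w).+1 <= n ^ (81 * w).
Proof.
move=> n1 w0; have n0 := ltnW n1.
have hn : n.+1 <= n ^ 2.
  rewrite -mulnn; apply: leq_trans (leq_mul n1 (leqnn n)).
  by rewrite mul2n -addnn -addn1 leq_add2l.
have hL : cell_count n w <= n ^ (80 * w).
  rewrite /cell_count /bag_bound /code_base -!expnM.
  apply: (@leq_trans ((n ^ 2) ^ (4 * (w.+1 * 5)))); first by rewrite leq_exp2r.
  by rewrite -expnM leq_pexp2l //; lia.
apply: (@leq_trans (2 * n ^ (80 * w))).
  by rewrite mul2n -addnn -addn1 leq_add // expn_gt0 n0.
apply: (@leq_trans (n ^ (80 * w).+1)); first by rewrite expnS leq_mul.
by rewrite leq_pexp2l //; lia.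
Qed.

(** The factor w for the rounds is absorbed by w < n ^ w, the polynomial by the bound on the number
    of cells. *)
Lemma search_time n w K : 1 < n -> 0 < w ->
  w * polyb K (cell_count n w) <= K * n ^ ((81 * K).+1 * w).
Proof.
move=> n1 w0; rewrite mulnCA leq_mul2l; apply/orP; right.
rewrite mulSn expnD leq_mul //; first exact/ltnW/ltn_expl.
rewrite mulnAC expnM; case: K => [//|K]; rewrite leq_exp2r //.
exact: cell_count_exp.
Qed.

Theorem theorem1 :
  exists (prog : cmd) (C : nat),
    forall (n : nat) (G : sgraph 'I_n) (k : nat) (l : seq ('I_n * 'I_n)),
      edge_list G l ->
      exists (t : nat) (m : memory),
        [/\ exec (encode l k) prog memory0 t m,
            m 0 != 0 <-> isometric_path_partition G k &
            t <= C * n ^ (C * treewidth G)].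
Proof.
have [c [K H]] := search_program.
pose nE := EInput (EConst 0); pose kE := EInput (EConst 1).
(* With truncated subtraction this value is 1 if n = k and 0 otherwise. *)
pose trivial := set_reg 0 (ESub (EConst 1) (EAdd (ESub nE kE) (ESub kE nE))).
(* The constant has to cover the exponent 81 * K + 1, the factor K together with 3 steps for the
   test, and the 18 steps of the branch without edges. *)
exists (CIf (EInput (EConst 2)) c trivial), (81 * K + 31) => n G k l Gl.
case: (posnP (size l)) => [l0|l_gt0].
  exists 18, (update memory0 0 (1 - ((n - k) + (k - n)))); split.
  - have E := exec_set_reg (encode l k) 0
      (ESub (EConst 1) (EAdd (ESub nE kE) (ESub kE nE))) memory0.
    exact: (@exec_IfF (encode l k) (EInput (EConst 2)) c trivial memory0 15 _ l0 E).
  - rewrite edgeless_partition; first by rewrite /update /=; lia.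
    by move=> u v; rewrite -(mem_edge Gl) (size0nil l0).
  - case: n G l Gl l0 => [|n] G l Gl l0; first by rewrite treewidth_void muln0 muln1; lia.
    by have := expn_gt0 n.+1 ((81 * K + 31) * treewidth G); rewrite orTb; nia.
have [u [v guv]] : exists u v, G u v.
  case: l Gl l_gt0 => // -[u v] l' Gl _; exists u, v.
  by rewrite -(mem_edge Gl) mem_head.
have tw0 := treewidth_edge guv.
have n1 : 1 < n.
  rewrite -[X in _ < X]card_ord; apply/card_gt1P; exists u, v; split=> //.
  by apply: contraTneq guv => ->; rewrite adj_irrefl.
have ex : exists w, final_table (encode l k) w.+1 n.
  exists (treewidth G).-1; rewrite prednK //; exact: final_table_treewidth.
case: (ex_minnP ex) => W hW minW.
have WT : W.+1 <= treewidth G.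
  rewrite -(prednK tw0) ltnS; apply: minW; rewrite prednK //.
  exact: final_table_treewidth.
have edges : size l <= cell_count n 1.
  apply: leq_trans (edge_list_size Gl) _; rewrite /cell_count /bag_bound /code_base.
  rewrite mulnn -!expnM; apply: (@leq_trans (n.+1 ^ 2)); first by rewrite leq_exp2r.
  by rewrite leq_pexp2l.
have [|t [m [h1 h2 h3]]] := H (encode l k) W (ltnW n1) edges _ hW.
  by move=> w hw; apply/negP => /minW; rewrite leqNgt hw.
exists (2 + t).+1, m; split.
- by apply: exec_IfT h1; rewrite /= -lt0n.
- have HC := final_table_correct Gl k hW; rewrite h3 eqb0 negbK.
  split=> [/andP[_ /HC]//|hk]; apply/andP; split; last exact/HC.
  exact: partition_card hk.
- have e := search_time K n1 (ltn0Sn W).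
  have := leq_trans h2 e => {}h2.
  have p1 : n ^ ((81 * K).+1 * W.+1) <= n ^ ((81 * K + 31) * treewidth G).
    by rewrite leq_pexp2l ?(ltnW n1) // leq_mul //; lia.
  have p0 : 0 < n ^ ((81 * K + 31) * treewidth G) by rewrite expn_gt0 (ltnW n1).
  have p2 := leq_mul (leqnn K) p1.
  by move: p0 p2 (leq_trans h2 p2); clear; move: (_ ^ _) => x; nia.
Qed.
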